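(* Let $k$ be a field and let $\Lambda=kQ/I$ be an admissible quotient of the path algebra $kQ$. Suppose that there are arrows $a_i\colon v_{e_i}\to v_{f_i}$ in $Q$ for $i=1,2,\dots,t$ which do not occur in a set of minimal generators of $I$ in $kQ$ and that $\operatorname{Hom}_\Lambda(e_i\Lambda,f_j\Lambda)=0$ for all $i$ and $j$ in $\{1,2,\dots,t\}$. Let $\Gamma=\Lambda/\Lambda\{\overline a_i\}_{i=1}^t\Lambda$, where $\overline a_i=a_i+I$. Then: (i) $\operatorname{fin.dim}\Lambda\le\max\{\operatorname{fin.dim}\Gamma,1\}$. (ii) $\operatorname{fin.dim}\Gamma\le\max\{\operatorname{fin.dim}\Lambda,1\}$. In particular, $\operatorname{fin.dim}\Lambda<\infty$ if and only if $\operatorname{fin.dim}\Gamma<\infty$.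
   Context: Admissible quotient means: $Q$ is a finite quiver and $I$ is a two-sided ideal of $kQ$ with $J^m\subseteq I\subseteq J^2$ for some $m\ge2$, where $J$ is the ideal generated by the arrows. Paths are composed from left to right, so for trivial paths (primitive idempotents) $e,f$ with corresponding vertices $v_e,v_f$, an arrow $a\colon v_e\to v_f$ satisfies $a=eaf$. ''The arrows $a_1,\dots,a_t$ do not occur in a set of minimal generators of $I$'' means that there is a minimal generating set of the two-sided ideal $I$ such that none of the $a_i$ occurs in any path appearing (with non-zero coefficient) in any element of that set. $\Lambda\{\overline a_i\}_{i=1}^t\Lambda$ is the two-sided ideal generated by the $\overline a_i$. Modules are right modules. $\operatorname{fin.dim}\Lambda$ is the supremum of the projective dimensions of all finitely generated right $\Lambda$-modules of finite projective dimension. *)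

(* Defs.v *)
From HB Require Import structures.
From mathcomp Require Import all_boot all_order all_algebra.
From mathcomp Require Import finmap monalg.
From mathcomp Require Import boolp classical_sets.

Set Implicit Arguments.
Unset Strict Implicit.
Unset Printing Implicit Defensive.

Import Order.TTheory GRing.Theory.

Local Open Scope ring_scope.
Local Open Scope classical_set_scope.

Record quiver := Quiver {
  vertex : finType;
  arrow : finType;
  src : arrow -> vertex;
  tgt : arrow -> vertex
}.

Section Paths.
Variable Q : quiver.

Fixpoint is_walk (v : vertex Q) (s : seq (arrow Q)) : bool :=
  if s is a :: s' then (src a == v) && is_walk (tgt a) s' else true.

(* A path is its starting vertex together with the sequence of its arrows,
   read from left to right; (v, [::]) is the trivial path at v. *)
Record qpath := QPath {
  qpath_val : vertex Q * seq (arrow Q);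
  _ : is_walk qpath_val.1 qpath_val.2
}.

HB.instance Definition _ := [isSub for qpath_val].
HB.instance Definition _ := [Choice of qpath by <:].

Definition psrc (p : qpath) : vertex Q := (qpath_val p).1.
Definition parrows (p : qpath) : seq (arrow Q) := (qpath_val p).2.
Definition ptgt (p : qpath) : vertex Q :=
  last (psrc p) [seq tgt a | a <- parrows p].

Definition trivial_path (v : vertex Q) : qpath := @QPath (v, [::]) isT.

Fact arrow_walk (a : arrow Q) : is_walk (src a) [:: a].
Proof. by rewrite /= eqxx. Qed.

Definition arrow_path (a : arrow Q) : qpath :=
  @QPath (src a, [:: a]) (arrow_walk a).

(* First p, then q; None when they are not composable.  The insub never fails
   (see val_pcat). *)
Definition pcat (p q : qpath) : option qpath :=
  if ptgt p == psrc q then insub (psrc p, parrows p ++ parrows q) else None.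

Lemma is_walk_cat v s1 s2 :
  is_walk v (s1 ++ s2) =
  is_walk v s1 && is_walk (last v [seq tgt a | a <- s1]) s2.
Proof. by elim: s1 v => //= a s1 IH v; rewrite IH andbA. Qed.

Lemma val_pcat p q : ptgt p = psrc q ->
  omap val (pcat p q) = Some (psrc p, parrows p ++ parrows q).
Proof.
move=> epq; rewrite /pcat epq eqxx insubT ?SubK //=.
rewrite is_walk_cat; apply/andP; split; first exact: (valP p).
by rewrite -/(ptgt p) epq; exact: (valP q).
Qed.

Lemma pcatP p q :
  if ptgt p == psrc q
  then exists2 r, pcat p q = Some r &
       [/\ psrc r = psrc p, ptgt r = ptgt q & parrows r = parrows p ++ parrows q]
  else pcat p q = None.
Proof.
case: eqP => [epq | /eqP/negbTE npq]; last by rewrite /pcat npq.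
have := val_pcat epq; case: (pcat p q) => //= r [er].
exists r => //; rewrite /ptgt /psrc /parrows er /= map_cat last_cat.
by rewrite -/(parrows p) -/(ptgt p) epq.
Qed.

Lemma qpath_inj p q : psrc p = psrc q -> parrows p = parrows q -> p = q.
Proof.
move=> es ea; apply: val_inj.
by rewrite [LHS]surjective_pairing [RHS]surjective_pairing; congr pair.
Qed.

Lemma pcatA p q r : obind (pcat^~ r) (pcat p q) = obind (pcat p) (pcat q r).
Proof.
have := pcatP p q; case: ifP => [/eqP epq [pq -> [spq tpq apq]] | npq -> /=].
  have := pcatP q r; case: ifP => [/eqP eqr [qr -> [sqr tqr aqr]] | nqr -> /=].
    have /= := pcatP pq r; rewrite tpq eqr eqxx => -[x -> [sx tx ax]].
    have := pcatP p qr; rewrite sqr epq eqxx => -[y -> [sy ty ay]].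
    congr Some; apply: qpath_inj; first by rewrite sx sy spq.
    by rewrite ax ay apq aqr catA.
  by have := pcatP pq r; rewrite tpq nqr.
have := pcatP q r; case: ifP => [/eqP eqr [qr -> [sqr tqr aqr]] | nqr -> //=].
by have := pcatP p qr; rewrite sqr npq.
Qed.

Lemma pcat1p v p : pcat (trivial_path v) p = if v == psrc p then Some p else None.
Proof.
have := pcatP (trivial_path v) p; have -> : ptgt (trivial_path v) = v by [].
case: ifP => [/eqP ev [r -> [sr _ ar]] | _ -> //].
by congr Some; apply: qpath_inj; rewrite ?sr ?ar.
Qed.

Lemma pcatp1 v p : pcat p (trivial_path v) = if ptgt p == v then Some p else None.
Proof.
have := pcatP p (trivial_path v); have -> : psrc (trivial_path v) = v by [].
case: ifP => [/eqP ev [r -> [sr _ ar]] | _ -> //].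
by congr Some; apply: qpath_inj; rewrite ?sr ?ar ?cats0.
Qed.

End Paths.

(* Finitely supported functions from paths to k; f@_p is the coefficient of p,
   msupp f the finite set of paths occurring in f. *)
Definition path_algebra (k : fieldType) (Q : quiver) : Type := {malg k[qpath Q]}.

HB.instance Definition _ (k : fieldType) (Q : quiver) :=
  GRing.Lmodule.copy (path_algebra k Q) {malg k[qpath Q]}.

Section PathAlgebra.
Variables (k : fieldType) (Q : quiver).
Local Notation kQ := (path_algebra k Q).
Implicit Types (f g h : kQ) (p q r : qpath Q).

Definition pa_basis (c : k) (o : option (qpath Q)) : kQ :=
  if o is Some r then << c *g r >> else 0.

Definition pa_one : kQ := \sum_(v : vertex Q) << trivial_path v >>.

Definition pa_mul (f g : kQ) : kQ :=
  \sum_(p <- msupp f) \sum_(q <- msupp g) pa_basis (f@_p * g@_q) (pcat p q).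

Fact pa_basis0 o : pa_basis 0 o = 0.
Proof. by case: o => //= p; rewrite monalgU0. Qed.

Fact pa_basisD c d o : pa_basis (c + d) o = pa_basis c o + pa_basis d o.
Proof. by case: o => [p|] /=; rewrite ?monalgUD ?addr0. Qed.

Fact pa_mulw (d1 d2 : {fset qpath Q}) f g :
    (msupp f `<=` d1)%fset -> (msupp g `<=` d2)%fset ->
  pa_mul f g =
  \sum_(p <- d1) \sum_(q <- d2) pa_basis (f@_p * g@_q) (pcat p q).
Proof.
move=> le1 le2; rewrite /pa_mul (big_fset_incl _ le1) /=; last first.
  move=> p _ /mcoeff_outdom ->; apply: big1 => q _.
  by rewrite mul0r pa_basis0.
apply: eq_bigr => p _; apply: (big_fset_incl _ le2) => q _ /mcoeff_outdom ->.
by rewrite mulr0 pa_basis0.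
Qed.

Fact pa_mulDl : left_distributive pa_mul +%R.
Proof.
move=> f g h; pose d := (msupp f `|` msupp g)%fset.
rewrite (@pa_mulw d (msupp h) f) ?fsubsetUl ?fsubset_refl //.
rewrite (@pa_mulw d (msupp h) g) ?fsubsetUr ?fsubset_refl //.
rewrite (@pa_mulw d (msupp h) (f + g)) ?msuppD_le ?fsubset_refl //.
rewrite -big_split; apply: eq_bigr => p _ /=.
rewrite -big_split; apply: eq_bigr => q _ /=.
by rewrite mcoeffD mulrDl pa_basisD.
Qed.

Fact pa_mulDr : right_distributive pa_mul +%R.
Proof.
move=> h f g; pose d := (msupp f `|` msupp g)%fset.
rewrite (@pa_mulw (msupp h) d _ f) ?fsubsetUl ?fsubset_refl //.
rewrite (@pa_mulw (msupp h) d _ g) ?fsubsetUr ?fsubset_refl //.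
rewrite (@pa_mulw (msupp h) d _ (f + g)) ?msuppD_le ?fsubset_refl //.
rewrite -big_split; apply: eq_bigr => p _ /=.
rewrite -big_split; apply: eq_bigr => q _ /=.
by rewrite mcoeffD mulrDr pa_basisD.
Qed.

Fact pa_mul0l f : pa_mul 0 f = 0.
Proof. by apply: (addrI (pa_mul 0 f)); rewrite -pa_mulDl !addr0. Qed.

Fact pa_mul0r f : pa_mul f 0 = 0.
Proof. by apply: (addrI (pa_mul f 0)); rewrite -pa_mulDr !addr0. Qed.

Fact pa_mul_suml (T : Type) (s : seq T) (F : T -> kQ) g :
  pa_mul (\sum_(i <- s) F i) g = \sum_(i <- s) pa_mul (F i) g.
Proof.
elim: s => [|i s IH]; first by rewrite !big_nil pa_mul0l.
by rewrite !big_cons pa_mulDl IH.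
Qed.

Fact pa_mul_sumr (T : Type) (s : seq T) (F : T -> kQ) g :
  pa_mul g (\sum_(i <- s) F i) = \sum_(i <- s) pa_mul g (F i).
Proof.
elim: s => [|i s IH]; first by rewrite !big_nil pa_mul0r.
by rewrite !big_cons pa_mulDr IH.
Qed.

Fact pa_mulUU c d p q :
  pa_mul << c *g p >> << d *g q >> = pa_basis (c * d) (pcat p q).
Proof.
rewrite (@pa_mulw [fset p]%fset [fset q]%fset) ?msuppU_le //.
by rewrite !big_seq_fset1 !mcoeffUU.
Qed.

Fact pa_mulA : associative pa_mul.
Proof.
move=> f g h; rewrite (monalgE f) [LHS]pa_mul_suml.
rewrite [X in _ = pa_mul X h]pa_mul_suml [RHS]pa_mul_suml; apply: eq_bigr => p _.
rewrite (monalgE g) [X in pa_mul _ X = _]pa_mul_suml [LHS]pa_mul_sumr.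
rewrite [X in _ = pa_mul X h]pa_mul_sumr [RHS]pa_mul_suml; apply: eq_bigr => q _.
rewrite (monalgE h) [X in pa_mul _ X = _]pa_mul_sumr [LHS]pa_mul_sumr.
rewrite [RHS]pa_mul_sumr; apply: eq_bigr => r _.
rewrite !pa_mulUU; set a := f@_p; set b := g@_q; set c := h@_r.
transitivity (pa_basis (a * (b * c)) (obind (pcat p) (pcat q r))).
  by case: (pcat q r) => [x|] /=; rewrite ?pa_mul0r ?pa_mulUU.
by rewrite -pcatA mulrA; case: (pcat p q) => [x|] /=; rewrite ?pa_mul0l ?pa_mulUU.
Qed.

Fact pa_mul1l : left_id pa_one pa_mul.
Proof.
move=> f; rewrite (monalgE f) pa_mul_sumr; apply: eq_bigr => p _.
rewrite pa_mul_suml (bigD1 (psrc p)) //= pa_mulUU pcat1p eqxx mul1r.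
rewrite big1 ?addr0 // => v nv.
by rewrite pa_mulUU pcat1p (negbTE nv).
Qed.

Fact pa_mul1r : right_id pa_one pa_mul.
Proof.
move=> f; rewrite (monalgE f) pa_mul_suml; apply: eq_bigr => p _.
rewrite pa_mul_sumr (bigD1 (ptgt p)) //= pa_mulUU pcatp1 eqxx mulr1.
rewrite big1 ?addr0 // => v nv.
by rewrite pa_mulUU pcatp1 eq_sym (negbTE nv).
Qed.

HB.instance Definition _ :=
  GRing.Zmodule_isPzRing.Build kQ pa_mulA pa_mul1l pa_mul1r pa_mulDl pa_mulDr.

Definition pa_idem (v : vertex Q) : kQ := << trivial_path v >>.
Definition pa_arrow (a : arrow Q) : kQ := << arrow_path a >>.

Definition arrow_occurs (a : arrow Q) (f : kQ) : Prop :=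
  exists2 p, p \in msupp f & a \in parrows p.

Lemma pa_arrowE (a : arrow Q) :
  pa_arrow a = pa_idem (src a) * pa_arrow a * pa_idem (tgt a).
Proof.
rewrite -[RHS]/(pa_mul (pa_mul _ _) _) pa_mulUU pcat1p eqxx /= pa_mulUU.
by rewrite pcatp1 eqxx !mulr1.
Qed.

End PathAlgebra.

Definition is_ideal (R : pzRingType) (A : set R) : Prop :=
  [/\ A 0, forall x y, A x -> A y -> A (x + y)
    & forall x y, A y -> A (x * y) /\ A (y * x)].

Record ideal (R : pzRingType) := Ideal {
  ideal_set :> set R;
  idealP : is_ideal ideal_set
}.

Fact smallest_is_ideal (R : pzRingType) (S : set R) : is_ideal (smallest (@is_ideal R) S).
Proof.
split=> [A [[A0 _ _] _] // | x y Sx Sy A AS | x y Sy].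
  by case: (AS) => -[_ AD _] _; apply: AD; [apply: Sx | apply: Sy].
by split=> A AS; case: (AS) => -[_ _ AM] _; case: (AM x y (Sy A AS)).
Qed.

Definition ideal_gen (R : pzRingType) (S : set R) : ideal R :=
  Ideal (smallest_is_ideal S).

Definition ideal_mul (R : pzRingType) (A B : ideal R) : ideal R :=
  ideal_gen [set x * y | x in A & y in B].

Fixpoint ideal_pow (R : pzRingType) (A : ideal R) (n : nat) : ideal R :=
  if n is n'.+1 then ideal_mul (ideal_pow A n') A else ideal_gen setT.

Definition minimal_generating_set (R : pzRingType) (A : ideal R) (G : set R) : Prop :=
  ideal_gen G = A :> set R /\
  forall G' : set R, G' `<=` G -> ideal_gen G' = A :> set R -> G' = G.

Section QuotientRing.
Variables (R : pzRingType) (I : ideal R).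

Definition ideal_pred : {pred R} := [pred x | `[< ideal_set I x >]].

Fact ideal_pred_zmod_closed : zmod_closed ideal_pred.
Proof.
case: (idealP I) => I0 ID IM; split; first exact/asboolP.
move=> x y /asboolP Ix /asboolP Iy; apply/asboolP; apply: ID => //.
by rewrite -mulN1r; case: (IM (-1) y Iy).
Qed.

HB.instance Definition _ :=
  GRing.isZmodClosed.Build R ideal_pred ideal_pred_zmod_closed.

Definition quot_ring : Type := Quotient.quot ideal_pred.

HB.instance Definition _ := GRing.Zmodule.copy quot_ring (Quotient.quot ideal_pred).

Definition quot_pi (x : R) : quot_ring := (\pi_(Quotient.quot ideal_pred) x)%qT.

Definition quot_repr (x : quot_ring) : R := repr (x : Quotient.quot ideal_pred).

Fact quot_reprK : cancel quot_repr quot_pi.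
Proof. by move=> x; exact: (@reprK _ (Quotient.quot ideal_pred)). Qed.

Lemma quot_piP x y : quot_pi x = quot_pi y <-> ideal_set I (x - y).
Proof.
have -> : ideal_set I (x - y) <-> x - y \in ideal_pred by split => /asboolP.
by rewrite Quotient.idealrBE; split => /eqP.
Qed.

Fact quot_pi_zmod : zmod_morphism quot_pi.
Proof. exact: (raddfB (\pi_(Quotient.quot ideal_pred))%qT). Qed.

Definition quot_one : quot_ring := quot_pi 1.
Definition quot_mul (x y : quot_ring) : quot_ring :=
  quot_pi (quot_repr x * quot_repr y).

Fact quot_piM x y : quot_pi (x * y) = quot_mul (quot_pi x) (quot_pi y).
Proof.
apply/quot_piP; set x' := quot_repr _; set y' := quot_repr _.
have [_ ID IM] := idealP I.
have -> : x * y - x' * y' = (x - x') * y + x' * (y - y').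
  by rewrite mulrBl mulrBr addrA subrK.
by apply: ID; [case: (IM y (x - x')) | case: (IM x' (y - y'))] => //;
  apply/quot_piP; rewrite quot_reprK.
Qed.

Fact quot_mulA : associative quot_mul.
Proof.
move=> x y z; rewrite -(quot_reprK x) -(quot_reprK y) -(quot_reprK z).
by rewrite -!quot_piM mulrA.
Qed.

Fact quot_mul1l : left_id quot_one quot_mul.
Proof. by move=> x; rewrite -(quot_reprK x) -quot_piM mul1r. Qed.

Fact quot_mul1r : right_id quot_one quot_mul.
Proof. by move=> x; rewrite -(quot_reprK x) -quot_piM mulr1. Qed.

Fact quot_piD x y : quot_pi (x + y) = quot_pi x + quot_pi y.
Proof. exact: (raddfD (\pi_(Quotient.quot ideal_pred))%qT). Qed.

Fact quot_mulDl : left_distributive quot_mul +%R.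
Proof.
move=> x y z; rewrite -(quot_reprK x) -(quot_reprK y) -(quot_reprK z).
by rewrite -quot_piD -!quot_piM -quot_piD mulrDl.
Qed.

Fact quot_mulDr : right_distributive quot_mul +%R.
Proof.
move=> x y z; rewrite -(quot_reprK x) -(quot_reprK y) -(quot_reprK z).
by rewrite -quot_piD -!quot_piM -quot_piD mulrDr.
Qed.

HB.instance Definition _ := GRing.Zmodule_isPzRing.Build quot_ring
  quot_mulA quot_mul1l quot_mul1r quot_mulDl quot_mulDr.

HB.instance Definition _ :=
  GRing.isZmodMorphism.Build R quot_ring quot_pi quot_pi_zmod.
HB.instance Definition _ :=
  GRing.isMonoidMorphism.Build R quot_ring quot_pi (conj (erefl _) quot_piM).

End QuotientRing.

Section Admissible.
Variables (k : fieldType) (Q : quiver).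

Definition arrow_ideal : ideal (path_algebra k Q) :=
  ideal_gen [set pa_arrow k a | a in [set: arrow Q]].

Definition admissible (I : ideal (path_algebra k Q)) : Prop :=
  exists m, [/\ (2 <= m)%N, ideal_pow arrow_ideal m `<=` I
              & I `<=` ideal_pow arrow_ideal 2].

End Admissible.

(* A right R-module is a left module over the opposite ring R^c. *)
Notation rmodType R := (lmodType R^c).

(* The right ideal e R of R, as a right R-module: a submodule of the regular
   right module R^c^o, in which r *: x is x * r computed in R. *)
Section PrincipalRightIdeal.
Variables (R : pzRingType) (e : R).

Definition in_right_ideal : {pred R^c^o} :=
  [pred x : R^c^o | `[< exists r : R, x = e * r >]].

Fact in_right_ideal_submod_closed : submod_closed in_right_ideal.
Proof.
split; first by apply/asboolP; exists 0; rewrite mulr0.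
move=> a x y /asboolP[r ->] /asboolP[s ->]; apply/asboolP.
by exists (r * a + s); rewrite mulrDr mulrA.
Qed.

HB.instance Definition _ :=
  GRing.isSubmodClosed.Build R^c R^c^o in_right_ideal in_right_ideal_submod_closed.

Record principal_right_ideal := PrincipalRightIdeal_of {
  principal_right_ideal_val : R^c^o;
  _ : principal_right_ideal_val \in in_right_ideal
}.

HB.instance Definition _ := [isSub for principal_right_ideal_val].
HB.instance Definition _ := [Choice of principal_right_ideal by <:].
HB.instance Definition _ := [SubChoice_isSubLmodule of principal_right_ideal by <:].

End PrincipalRightIdeal.

Definition Hom_trivial (R : pzRingType) (M N : lmodType R) : Prop :=
  forall (f : {linear M -> N}) (x : M), f x = 0.

Variant enat := Fin of nat | Infty.

Definition option_of_enat (x : enat) : option nat :=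
  if x is Fin n then Some n else None.
Definition enat_of_option (x : option nat) : enat :=
  if x is Some n then Fin n else Infty.
Fact option_of_enatK : cancel option_of_enat enat_of_option.
Proof. by case. Qed.

HB.instance Definition _ := Choice.copy enat (can_type option_of_enatK).

Definition enat_le (x y : enat) : bool :=
  match x, y with
  | _, Infty => true
  | Infty, Fin _ => false
  | Fin m, Fin n => (m <= n)%N
  end.

Fact enat_le_anti : antisymmetric enat_le.
Proof. by case=> [m|] [n|] //= H; congr Fin; apply/eqP; rewrite eqn_leq. Qed.

Fact enat_le_trans : transitive enat_le.
Proof. by case=> [m|] [n|] [p|] //=; apply: leq_trans. Qed.

Fact enat_le_total : total enat_le.
Proof. by case=> [m|] [n|] //=; apply: leq_total. Qed.

Fact enat_display : Order.disp_t. Proof. by []. Qed.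

HB.instance Definition _ := Order.isOrder.Build enat_display enat
  (fun _ _ => erefl) (fun _ _ => erefl) (fun _ _ => erefl)
  enat_le_anti enat_le_trans enat_le_total.

(* The least element of A, and Infty if A is empty. *)
Definition enat_inf (A : set nat) : enat :=
  if pselect (exists n, `[< A n >]) is left exA then Fin (ex_minn exA) else Infty.

Definition enat_sup (A : set enat) : enat :=
  enat_inf [set n | forall x, A x -> (x <= Fin n)%O].

Lemma enat_infP (A : set nat) (n : nat) :
  (enat_inf A <= Fin n)%O <-> exists2 m, A m & (m <= n)%N.
Proof.
rewrite /enat_inf; case: pselect => [exA | nA] /=; last first.
  by split=> // -[m Am _]; case: nA; exists m; apply/asboolP.
case: ex_minnP => m /asboolP Am minm; split; first by exists m.
by case=> p /asboolP Ap; apply: leq_trans (minm p Ap).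
Qed.

Lemma enat_sup_le (A : set enat) (y : enat) :
  (enat_sup A <= y)%O <-> forall x, A x -> (x <= y)%O.
Proof.
case: y => [n|]; last by split=> [_ [] // | _]; case: enat_sup.
rewrite enat_infP; split=> [[m ubm mn] x /ubm xm | ubn]; last by exists n.
by apply: le_trans xm _.
Qed.

Definition projective (R : pzRingType) (P : lmodType R) : Prop :=
  forall (M N : lmodType R) (g : {linear M -> N}) (f : {linear P -> N}),
    (forall y, exists x, g x = y) ->
    exists h : {linear P -> M}, forall x, g (h x) = f x.

(* M has a projective resolution
     0 -> P n -> ... -> P 1 -> P 0 -> M -> 0,
   the terms of degree > n being zero. *)
Definition has_projective_resolution (R : pzRingType) (M : lmodType R) (n : nat) : Prop :=
  exists (P : nat -> lmodType R) (d : forall i, {linear P i.+1 -> P i})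
         (eps : {linear P 0%N -> M}),
    [/\ forall i, projective (P i),
        forall i, (n < i)%N -> forall x : P i, x = 0,
        forall y, exists x, eps x = y,
        forall x, eps x = 0 <-> exists y, d 0%N y = x
      & forall i x, d i x = 0 <-> exists y, d i.+1 y = x].

Definition proj_dim (R : pzRingType) (M : lmodType R) : enat :=
  enat_inf [set n | has_projective_resolution M n].

Definition finitely_generated (R : pzRingType) (M : lmodType R) : Prop :=
  exists (n : nat) (x : 'I_n -> M),
    forall y, exists c : 'I_n -> R, y = \sum_i c i *: x i.

Definition fin_dim (R : pzRingType) : enat :=
  enat_sup [set d | exists M : rmodType R,
    [/\ finitely_generated M, (proj_dim M < Infty)%O & proj_dim M = d]].

(* Main.v *)
(* Let L be the ideal of Lam generated by the removed arrows. As no relation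
   involves them, killing them is an algebra endomorphism of Lam, which splits
   Lam -> Gam, and L is the direct sum of the bimodules Gam e_i (x)_k f_i Gam, there
   being no path from f_j to e_i. So Lam is projective on both sides over Gam, and
   induction and restriction between Gam- and Lam-modules are exact and preserve
   projectives. A Gam-module Z is a retract of the restriction of the induced module
   Ind Z, whence (ii). For a Lam-module X, the counit Ind (Res X) -> X is surjective
   and its kernel is the direct sum of the X e_i (x)_k f_i Lam, which is projective,
   so that pd X <= max (pd (Res X), 1), whence (i). *)

From HB Require Import structures.
Require Import Defs.
From mathcomp Require Import all_boot all_order all_algebra.
From mathcomp Require Import finmap monalg.
From mathcomp Require Import boolp classical_sets.

Set Implicit Arguments.
Unset Strict Implicit.
Unset Printing Implicit Defensive.

Import Order.TTheory GRing.Theory.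
Local Open Scope ring_scope.

(** Tensor products are never formed: each bimodule is given by a finite dual basis, and an induced
    module is the image of an idempotent matrix on Z^J. The coordinates come from a noncommutative
    partial derivative. For a removed arrow a, the double derivation kQ -> kQ (x) kQ sends a path to
    the sum of the p (x) q over its factorizations p a q. It obeys the Leibniz rule and kills the
    chosen generators of I, so it descends to Lam. Cutting at the first removed arrow gives Lam =
    Gam + sum of the Gam e_i (x)_k f_i Lam as left Gam-modules; cutting at the last one gives the
    mirror image. The inclusion of J^m in I makes Lam finite dimensional and so the dual bases
    finite. The Hom condition yields f_j Lam e_i = 0: after a removed arrow no other can follow,
    which makes the kernel of the counit computable. The constant 1 is the cost of passing from Ind
    (Res X) to its quotient X by a projective submodule. *)

Definition mk_linear (R : pzRingType) (U V : lmodType R) (f : U -> V)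
    (fL : linear f) : {linear U -> V} :=
  HB.pack f (GRing.isLinear.Build R U V *:%R f fL).

(** * Projective dimension *)

Section Kernel.
Variables (R : pzRingType) (U V : lmodType R) (f : {linear U -> V}).

Definition ker_pred : {pred U} := [pred x | f x == 0].

Fact ker_submod_closed : submod_closed ker_pred.
Proof.
split; first by rewrite inE linear0.
by move=> a x y; rewrite !inE linearP => /eqP-> /eqP->; rewrite scaler0 addr0.
Qed.

HB.instance Definition _ :=
  GRing.isSubmodClosed.Build R U ker_pred ker_submod_closed.

Record kernel := Kernel { kernel_val : U; _ : kernel_val \in ker_pred }.

HB.instance Definition _ := [isSub for kernel_val].
HB.instance Definition _ := [Choice of kernel by <:].
HB.instance Definition _ := [SubChoice_isSubLmodule of kernel by <:].

Lemma kernelP (x : kernel) : f (val x) = 0.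
Proof. by apply/eqP; exact: (valP x). Qed.

Lemma kernel_ex x : f x = 0 -> exists y : kernel, val y = x.
Proof. by move=> /eqP fx; exists (Kernel fx). Qed.

Fact kernel_inc_linear : linear (val : kernel -> U).
Proof. by move=> a x y; rewrite linearP. Qed.

Definition kernel_inc := mk_linear kernel_inc_linear.

Lemma kernel_lift (W : lmodType R) (g : {linear W -> U}) :
  (forall x, f (g x) = 0) ->
  exists h : {linear W -> kernel}, forall x, val (h x) = g x.
Proof.
move=> fg; have fg' x : g x \in ker_pred by apply/eqP.
have hL : linear (fun x => Kernel (fg' x)).
  by move=> a x y; apply: val_inj; rewrite [RHS]linearP /= linearP.
by exists (mk_linear hL).
Qed.

End Kernel.

Lemma lin_surj_bij_inv (R : pzRingType) (U V : lmodType R) (f : {linear U -> V}) :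
  (forall y, exists x, f x = y) -> injective f ->
  exists g : {linear V -> U}, forall y, f (g y) = y.
Proof.
move=> /choice[g gK] fI.
have gL : linear g by move=> a x y; apply: fI; rewrite linearP !gK.
by exists (mk_linear gL).
Qed.

Section Projective.
Variable R : pzRingType.
Implicit Types M N P K X : lmodType R.

Lemma projective_retract P M (s : {linear M -> P}) (r : {linear P -> M}) :
  (forall x, r (s x) = x) -> projective P -> projective M.
Proof.
move=> rs prP U V g f gS; have [h gh] := prP _ _ g (f \o r) gS.
by exists (h \o s) => x; rewrite /= gh /= rs.
Qed.

Lemma projective_prod M N : projective M -> projective N -> projective (M * N)%type.
Proof.
move=> prM prN U V g f gS.
have f1L : linear (fun x : M => f (x, 0)).
  move=> a x y; rewrite -linearP; congr (f _).
  by apply: injective_projections => //=; rewrite scaler0 addr0.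
have f2L : linear (fun x : N => f (0, x)).
  move=> a x y; rewrite -linearP; congr (f _).
  by apply: injective_projections => //=; rewrite scaler0 addr0.
have [h1 gh1] := prM _ _ g (mk_linear f1L) gS.
have [h2 gh2] := prN _ _ g (mk_linear f2L) gS.
have hL : linear (fun x : M * N => h1 x.1 + h2 x.2).
  by move=> a x y; rewrite !linearP /= scalerDr addrACA.
exists (mk_linear hL) => -[x y] /=; rewrite linearD gh1 gh2 /= -linearD.
by congr (f _); apply: injective_projections => /=; rewrite ?addr0 ?add0r.
Qed.

(** Half of the dual basis lemma: lifts are chosen at the vectors [m j] only, and the forms [c j]
    extend them linearly. *)
Lemma projective_dual_basis (J : finType) M (m : J -> M) (c : J -> {linear M -> R^o}) :
  (forall x, x = \sum_j (c j x : R) *: m j) -> projective M.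
Proof.
move=> mc U V g f gS; have /choice[l gl] : forall j, exists y, g y = f (m j).
  by move=> j; apply: gS.
have hL : linear (fun x => \sum_j (c j x : R) *: l j).
  move=> a x y; rewrite scaler_sumr -big_split; apply: eq_bigr => j _ /=.
  by rewrite linearP scalerDl scalerA.
exists (mk_linear hL) => x /=; rewrite linear_sum {2}[x]mc linear_sum.
by apply: eq_bigr => j _; rewrite !linearZ gl.
Qed.

(** The syzygy is any [K] with an injection onto the kernel of [g], not that kernel itself, so that
    an exact functor turns such data into data of the same kind. *)
Fixpoint pd_le (n : nat) M : Prop :=
  if n is n'.+1 then
    exists (P K : lmodType R) (g : {linear P -> M}) (j : {linear K -> P}),
      [/\ projective P, forall y, exists x, g x = y, injective j,
          forall x, g x = 0 <-> exists y, j y = x & pd_le n' K]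
  else projective M.

Lemma pd_le_prod n M N : pd_le n M -> projective N -> pd_le n (M * N)%type.
Proof.
case: n => [|n] /=; first exact: projective_prod.
move=> [P [K [g [j [prP gS jI kerg pdK]]]]] prN.
have gL : linear (fun x : P * N => (g x.1, x.2)).
  by move=> a x y; apply: injective_projections; rewrite //= linearP.
have jL : linear (fun x : K => (j x, 0 : N)).
  by move=> a x y; apply: injective_projections; rewrite /= ?linearP ?scaler0 ?addr0.
exists (P * N)%type, K, (mk_linear gL), (mk_linear jL); split=> //=.
- exact: projective_prod.
- by move=> [y z]; have [x <-] := gS y; exists (x, z).
- by move=> x y [/jI].
move=> [x z] /=; split=> [[/kerg[y <-] ->] | [y [<- <-]]]; first by exists y.
by rewrite pair_equal_spec; split=> //; apply/kerg; exists y.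
Qed.

(* With [theta] a lift of the idempotent [s r] along [P -> M], the kernel of
   [P -> M -> N] is a retract of [K * P]: the section is [p |-> (theta p, p)]
   and the retraction [(q, x) |-> q + x - theta x]. *)
Lemma pd_le_retract n M N (s : {linear N -> M}) (r : {linear M -> N}) :
  (forall x, r (s x) = x) -> pd_le n M -> pd_le n N.
Proof.
elim: n M N s r => [|n IH] M N s r rs /=; first exact: projective_retract rs.
move=> [P [K [g [j [prP gS jI kerg pdK]]]]].
have [theta gtheta] := prP _ _ g (s \o r \o g) gS.
pose rg : {linear P -> N} := r \o g.
exists P, (kernel rg), rg, (kernel_inc rg); split=> //.
- by move=> y; have [x gx] := gS (s y); exists x; rewrite /= gx rs.
- exact: val_inj.
- by move=> x; split=> [/kernel_ex // | [y <-]]; apply: kernelP.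
have jS (x : P) : g x = 0 -> exists y, j y = x by move=> /kerg.
have gj y : g (j y) = 0 by apply/kerg; exists y.
have thetaK (x : kernel rg) : exists y, j y = theta (val x).
  apply: jS; rewrite gtheta /=; have /= -> := kernelP x.
  exact: linear0.
have [u uE] := choice thetaK.
have uL : linear (fun x : kernel rg => (u x, val x)).
  move=> a x y; apply: injective_projections; rewrite /= ?linearP //.
  by apply: jI; rewrite linearP !uE !linearP.
have vL : linear (fun z : K * P => j z.1 + (z.2 - theta z.2)).
  move=> a x y; rewrite scalerDr [RHS]addrACA -linearP; congr (_ + _).
  by rewrite /= linearP scalerBr opprD addrACA.
have v0 z : rg (mk_linear vL z) = 0.
  rewrite /= linearD gj add0r linearB gtheta /=.
  by rewrite linearB rs subrr.
have [w wE] := kernel_lift v0.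
apply: (IH (K * P)%type (kernel rg) (mk_linear uL) w); last exact: pd_le_prod.
by move=> x; apply: val_inj; rewrite wE /= uE addrC subrK.
Qed.

Lemma pd_leP n M : has_projective_resolution M n <-> pd_le n M.
Proof.
split.
  elim: n M => [|n IH] M [P [d [eps [prP P0 epsS epsK dK]]]] /=.
    have epsI : injective eps.
      move=> x y /eqP; rewrite -subr_eq0 -linearB => /eqP/epsK[z zE].
      by apply/eqP; rewrite -subr_eq0 -zE [z]P0 ?linear0.
    have [g gK] := lin_surj_bij_inv epsS epsI.
    exact: projective_retract gK (prP 0).
  have d0 x : eps (d 0 x) = 0 by apply/epsK; exists x.
  have [eps' eps'E] := kernel_lift d0.
  exists (P 0), (kernel eps), eps, (kernel_inc eps); split=> //.
  - exact: val_inj.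
  - by move=> x; split=> [/kernel_ex // | [y <-]]; apply: kernelP.
  apply: IH; exists (fun i => P i.+1), (fun i => d i.+1), eps'; split=> //.
  - by move=> i ni; apply: P0.
  - move=> y; have /epsK[x xE] := kernelP y; exists x.
    by apply: val_inj; rewrite eps'E.
  - move=> x; rewrite -dK -eps'E; split=> [-> | e0]; first exact: linear0.
    by apply: val_inj; rewrite e0 linear0.
elim: n M => [|n IH] M /=.
  (* [Z] is the zero module, which fills the positive degrees. *)
  move=> prM; pose Z : lmodType R := 'rV[R]_0.
  have Z0 (x : Z) : x = 0 by apply/rowP => -[].
  pose P i : lmodType R := if i is 0 then M else Z.
  have zL (U V : lmodType R) : linear (fun _ : U => 0 : V).
    by move=> a x y; rewrite scaler0 addr0.
  exists P, (fun i => mk_linear (zL (P i.+1) (P i))), (idfun : {linear M -> M}).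
  split=> //.
  - case=> [//|i] U V g f _; exists (mk_linear (zL Z U)) => x.
    by rewrite [x]Z0 !linear0.
  - by case.
  - by move=> y; exists y.
  - by move=> x; split=> [x0 | [_ <-]] //; exists 0; exact/esym/x0.
  - by move=> i x; split=> [_ | //]; exists 0; rewrite [x]Z0.
move=> [P [K [g [j [prP gS jI kerg /IH]]]]].
move=> [P' [d' [eps' [prP' P'0 eps'S eps'K d'K]]]].
pose S i : lmodType R := if i is i'.+1 then P' i' else P.
pose dS i : {linear S i.+1 -> S i} :=
  match i return {linear S i.+1 -> S i} with
  | 0 => j \o eps'
  | i'.+1 => d' i'
  end.
exists S, dS, g; split=> //.
- by case.
- by case=> // i ni; apply: P'0.
- move=> x; rewrite kerg; split=> [[y <-] | [y <-]]; last by exists (eps' y).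
  by have [z <-] := eps'S y; exists z.
case=> [|i] x; last exact: d'K.
rewrite -eps'K /=; split=> [e0 | ->]; last exact: linear0.
by apply: jI; rewrite linear0.
Qed.

(* Replace K by [K * N] in [K -> P -> M]: the mapping cone of a lift [N -> P] of
   the inclusion [N -> M]. *)
Lemma pd_le_coker n M N X (q : {linear M -> X}) (i : {linear N -> M}) :
  (forall y, exists x, q x = y) -> injective i ->
  (forall x, q x = 0 <-> exists y, i y = x) ->
  projective N -> pd_le n.+1 M -> pd_le n.+1 X.
Proof.
move=> qS iI kerq prN [P [K [g [j [prP gS jI kerg pdK]]]]].
have [l gl] := prN _ _ g i gS.
have kL : linear (fun z : K * N => j z.1 + l z.2).
  by move=> a x y; rewrite !linearP /= scalerDr addrACA.
have gj y : g (j y) = 0 by apply/kerg; exists y.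
have gk z : g (mk_linear kL z) = i z.2 by rewrite /= linearD gj add0r gl.
exists P, (K * N)%type, (q \o g), (mk_linear kL); split=> //.
- by move=> y; have [x <-] := qS y; have [z <-] := gS x; exists z.
- move=> z z' ezz'; have e2 : z.2 = z'.2 by apply: iI; rewrite -!gk ezz'.
  move: z z' ezz' e2 => [x y] [x' y'] /= + e2; rewrite -e2.
  by move=> /addIr/jI ->.
- move=> x; rewrite /= kerq; split=> [[y yE] | [z <-]]; last first.
    by exists z.2; rewrite gk.
  have /kerg[w wE] : g (x - l y) = 0 by rewrite linearB gl yE subrr.
  by exists (w, y); rewrite /= wE subrK.
exact: pd_le_prod.
Qed.

Lemma has_projective_resolution_mono n m M : (n <= m)%N ->
  has_projective_resolution M n -> has_projective_resolution M m.
Proof.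
move=> nm [P [d [eps [prP P0 epsS epsK dK]]]]; exists P, d, eps; split=> // i mi.
by apply: P0; apply: leq_ltn_trans mi.
Qed.

Lemma pd_le_mono n m M : (n <= m)%N -> pd_le n M -> pd_le m M.
Proof. by move=> nm; rewrite -!pd_leP; apply: has_projective_resolution_mono. Qed.

Lemma proj_dim_leP M n : (proj_dim M <= Fin n)%O <-> pd_le n M.
Proof.
rewrite enat_infP -pd_leP; split=> [[m resm mn] | resn]; last by exists n.
exact: has_projective_resolution_mono resm.
Qed.

End Projective.

Lemma pd_le_functor (A B : pzRingType) (F : lmodType A -> lmodType B)
    (Fm : forall M N : lmodType A, {linear M -> N} -> {linear F M -> F N}) :
  (forall P, projective P -> projective (F P)) ->
  (forall (M N : lmodType A) (g : {linear M -> N}), (forall y, exists x, g x = y) ->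
     forall y, exists x, Fm _ _ g x = y) ->
  (forall (M N : lmodType A) (g : {linear M -> N}),
     injective g -> injective (Fm _ _ g)) ->
  (forall (M N X : lmodType A) (g : {linear M -> N}) (f : {linear X -> M}),
     injective f -> (forall x, g x = 0 <-> exists y, f y = x) ->
     forall x, Fm _ _ g x = 0 <-> exists y, Fm _ _ f y = x) ->
  forall n M, pd_le n M -> pd_le n (F M).
Proof.
move=> Fproj Fsurj Finj Fex; elim=> [|n IH] M /=; first exact: Fproj.
move=> [P [K [g [j [prP gS jI kerg pdK]]]]].
exists (F P), (F K), (Fm _ _ g), (Fm _ _ j); split; [exact: Fproj|exact: Fsurj| | |].
- exact: Finj.
- exact: Fex.
- exact: IH.
Qed.

(** * Finitistic dimension *)

Section FinDim.
Variable R : pzRingType.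

Lemma fin_dim_leP y : (fin_dim R <= y)%O <->
  forall M : rmodType R, finitely_generated M -> (proj_dim M < Infty)%O ->
    (proj_dim M <= y)%O.
Proof.
rewrite enat_sup_le; split=> [H M fgM pdM | H _ [M [fgM pdM <-]]].
  by apply: H; exists M.
exact: H.
Qed.

End FinDim.

Lemma enat_ltInftyP (x : enat) : (x < Infty)%O <-> exists n, x = Fin n.
Proof.
case: x => [n|]; split=> //; first by exists n.
by case.
Qed.

(** The bound [pd_le n M'] makes the projective dimension of [M'] finite, so that [M'] counts in
    [fin_dim R']; the last condition is then applied with m = [fin_dim R']. *)
Lemma fin_dim_le_max (R R' : pzRingType) (c : nat) :
  (forall (M : rmodType R) n, finitely_generated M -> pd_le n M ->
     exists M' : rmodType R', [/\ finitely_generated M', pd_le n M'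
       & forall m, pd_le m M' -> pd_le (maxn m c) M]) ->
  (fin_dim R <= Order.max (fin_dim R') (Fin c))%O.
Proof.
move=> RR'; apply/fin_dim_leP => M Mfg /enat_ltInftyP[n pdM].
have /proj_dim_leP/(RR' _ _ Mfg)[M' [M'fg M'n M'M]] : (proj_dim M <= Fin n)%O.
  by rewrite pdM.
have pdM' : (proj_dim M' < Infty)%O.
  have /proj_dim_leP : pd_le n M' by [].
  by case: (proj_dim M').
have := (fin_dim_leP R' _).1 (lexx _) M' M'fg pdM'.
case: (fin_dim R') => [d|] /=; last by rewrite le_max; case: (proj_dim M).
move=> /proj_dim_leP/M'M; rewrite -proj_dim_leP => /le_trans; apply.
by rewrite le_max; case: leqP => _; rewrite lexx ?orbT.
Qed.

(** * Induction and restriction *)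

Lemma finitely_generatedI (R : pzRingType) (J : finType) (M : lmodType R) (x : J -> M) :
  (forall y, exists c : J -> R, y = \sum_j c j *: x j) -> finitely_generated M.
Proof.
move=> xE; exists #|J|, (fun i => x (enum_val i)) => y; have [c yE] := xE y.
exists (fun i => c (enum_val i)).
by rewrite yE -(big_enum_val (fun j => c j *: x j)).
Qed.

(** A copy of M tagged by [iota], which keeps its B-action apart from the A-action of M. *)
Definition restr (A B : pzRingType) (iota : {rmorphism B -> A})
  (M : lmodType A) : Type := M.

Section Restriction.
Variables (A B : pzRingType) (iota : {rmorphism B -> A}).
Local Notation restr := (restr iota).

Section RestrModule.
Variable M : lmodType A.

HB.instance Definition _ := GRing.Zmodule.on (restr M).

Definition restr_scale (b : B) (x : restr M) : restr M := iota b *: (x : M).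

Fact restr_scaleA b c x : restr_scale b (restr_scale c x) = restr_scale (b * c) x.
Proof. by rewrite /restr_scale scalerA rmorphM. Qed.

Fact restr_scale1 : left_id 1 restr_scale.
Proof. by move=> x; rewrite /restr_scale rmorph1 scale1r. Qed.

Fact restr_scaleDr : right_distributive restr_scale +%R.
Proof. by move=> b x y; apply: scalerDr. Qed.

Fact restr_scaleDl x : {morph restr_scale^~ x : b c / b + c}.
Proof. by move=> b c; rewrite /restr_scale rmorphD scalerDl. Qed.

HB.instance Definition _ := GRing.Zmodule_isLmodule.Build B (restr M)
  restr_scaleA restr_scale1 restr_scaleDr restr_scaleDl.

Lemma restrZ b (x : restr M) : b *: x = iota b *: (x : M) :> M.
Proof. by []. Qed.

End RestrModule.

Fact restr_map_linear (M N : lmodType A) (g : {linear M -> N}) :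
  linear (g : restr M -> restr N).
Proof. by move=> b x y; rewrite !restrZ; apply: linearP. Qed.

Definition restr_map (M N : lmodType A) (g : {linear M -> N}) :
  {linear restr M -> restr N} :=
  mk_linear (restr_map_linear g).

End Restriction.

(* A multiplicative, not necessarily unital, map [A -> M_J(B)]: it makes the
   image of the idempotent [rep 1] on [Z^J] an A-module, for every B-module Z. *)
Record mx_rep (A B : pzRingType) (J : finType) := MxRep {
  rep :> A -> J -> J -> B;
  repD : forall a b i j, rep (a + b) i j = rep a i j + rep b i j;
  repM : forall a b i j, rep (a * b) i j = \sum_l rep a i l * rep b l j
}.

Section Transfer.
Variables (A B : pzRingType) (J : finType) (rho : mx_rep A B J).

Definition rep_act (Z : lmodType B) (a : A) (z : {ffun J -> Z}) : {ffun J -> Z} :=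
  [ffun i => \sum_j rho a i j *: z j].

Section TransferModule.
Variable Z : lmodType B.
Implicit Types z : {ffun J -> Z}.

Lemma rep_actA a b z : rep_act a (rep_act b z) = rep_act (a * b) z.
Proof.
apply/ffunP => i; rewrite !ffunE.
under eq_bigr => j _ do rewrite ffunE scaler_sumr.
rewrite exchange_big; apply: eq_bigr => l _ /=.
by rewrite repM scaler_suml; apply: eq_bigr => j _; rewrite scalerA.
Qed.

Lemma rep_actDr a z z' : rep_act a (z + z') = rep_act a z + rep_act a z'.
Proof.
apply/ffunP => i; rewrite !ffunE -big_split; apply: eq_bigr => j _.
by rewrite ffunE scalerDr.
Qed.

Lemma rep_actBr a z z' : rep_act a (z - z') = rep_act a z - rep_act a z'.
Proof.
apply/ffunP => i; rewrite !ffunE -sumrB; apply: eq_bigr => j _.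
by rewrite !ffunE scalerBr.
Qed.

Lemma rep_actDl a b z : rep_act (a + b) z = rep_act a z + rep_act b z.
Proof.
apply/ffunP => i; rewrite !ffunE -big_split; apply: eq_bigr => j _.
by rewrite repD scalerDl.
Qed.

Definition transfer_pred : {pred {ffun J -> Z}} := [pred z | rep_act 1 z == z].

Fact transfer_zmod_closed : zmod_closed transfer_pred.
Proof.
split; last by move=> z z' /eqP ez /eqP ez'; rewrite inE rep_actBr ez ez'.
by rewrite inE -{1}[0](subrr 0) rep_actBr subrr.
Qed.

HB.instance Definition _ :=
  GRing.isZmodClosed.Build {ffun J -> Z} transfer_pred transfer_zmod_closed.

Record transfer := Transfer {
  transfer_val : {ffun J -> Z};
  _ : transfer_val \in transfer_pred
}.

HB.instance Definition _ := [isSub for transfer_val].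
HB.instance Definition _ := [Choice of transfer by <:].
HB.instance Definition _ := [SubChoice_isSubZmodule of transfer by <:].

Lemma transfer1 (z : transfer) : rep_act 1 (val z) = val z.
Proof. exact/eqP/(valP z). Qed.

Fact rep_act_transfer a z : rep_act a z \in transfer_pred.
Proof. by rewrite inE rep_actA mul1r. Qed.

Definition transfer_mk a z : transfer := Transfer (rep_act_transfer a z).

Definition transfer_scale a (z : transfer) : transfer := transfer_mk a (val z).

Fact transfer_scaleA a b (z : transfer) :
  transfer_scale a (transfer_scale b z) = transfer_scale (a * b) z.
Proof. by apply: val_inj; rewrite /= rep_actA. Qed.

Fact transfer_scale1 : left_id 1 transfer_scale.
Proof. by move=> z; apply: val_inj; rewrite /= transfer1. Qed.

Fact transfer_scaleDr : right_distributive transfer_scale +%R.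
Proof. by move=> a z z'; apply: val_inj; rewrite [RHS]raddfD /= -rep_actDr. Qed.

Fact transfer_scaleDl (z : transfer) : {morph transfer_scale^~ z : a b / a + b}.
Proof. by move=> a b; apply: val_inj; rewrite [RHS]raddfD /= rep_actDl. Qed.

HB.instance Definition _ := GRing.Zmodule_isLmodule.Build A transfer
  transfer_scaleA transfer_scale1 transfer_scaleDr transfer_scaleDl.

Lemma val_transferZ a (z : transfer) i :
  val (a *: z) i = \sum_j rho a i j *: val z j.
Proof. by rewrite /= ffunE. Qed.

Lemma val_transferD (z z' : transfer) i : val (z + z') i = val z i + val z' i.
Proof. by rewrite raddfD ffunE. Qed.

Lemma val_transferB (z z' : transfer) i : val (z - z') i = val z i - val z' i.
Proof. by rewrite raddfB !ffunE. Qed.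

Lemma transfer_ffunP (z z' : transfer) : (forall i, val z i = val z' i) -> z = z'.
Proof. by move=> ezz'; apply/val_inj/ffunP. Qed.

Lemma transfer_ex (z : J -> Z) :
  (forall i, \sum_j rho 1 i j *: z j = z i) ->
  exists z' : transfer, forall i, val z' i = z i.
Proof.
move=> ez; pose zf : {ffun J -> Z} := [ffun i => z i].
have zP : zf \in transfer_pred.
  apply/eqP/ffunP => i; rewrite !ffunE -ez; apply: eq_bigr => j _.
  by rewrite ffunE.
by exists (Transfer zP) => i; rewrite ffunE.
Qed.

End TransferModule.

Section TransferMap.
Variables (M N : lmodType B) (g : {linear M -> N}).

Definition ffun_map (z : {ffun J -> M}) : {ffun J -> N} := [ffun i => g (z i)].

Lemma rep_act_map a z : ffun_map (rep_act a z) = rep_act a (ffun_map z).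
Proof.
apply/ffunP => i; rewrite !ffunE linear_sum; apply: eq_bigr => j _.
by rewrite linearZ ffunE.
Qed.

Fact transfer_map_subproof (z : transfer M) : ffun_map (val z) \in @transfer_pred N.
Proof. by rewrite inE -rep_act_map transfer1. Qed.

Definition transfer_map_fun z : transfer N := Transfer (transfer_map_subproof z).

Fact transfer_map_funE z i : val (transfer_map_fun z) i = g (val z i).
Proof. by rewrite /= ffunE. Qed.

Fact transfer_map_linear : linear transfer_map_fun.
Proof.
move=> a x y; apply: transfer_ffunP => i.
rewrite val_transferD val_transferZ !transfer_map_funE val_transferD.
rewrite val_transferZ linearD linear_sum; congr (_ + _); apply: eq_bigr => j _.
by rewrite linearZ transfer_map_funE.
Qed.

Definition transfer_map : {linear transfer M -> transfer N} :=
  mk_linear transfer_map_linear.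

Lemma val_transfer_map z i : val (transfer_map z) i = g (val z i).
Proof. exact: transfer_map_funE. Qed.

Lemma transfer_map_surj : (forall y, exists x, g x = y) ->
  forall y, exists x, transfer_map x = y.
Proof.
(* Pointwise preimages need not form an element of [transfer M]. The idempotent [rep_act 1] moves
   them there without changing their image, as it fixes y. *)
move=> /choice[h hK] y; pose z : {ffun J -> M} := [ffun i => h (val y i)].
exists (transfer_mk 1 z); apply: val_inj; rewrite /= rep_act_map.
rewrite -[RHS]transfer1; congr (rep_act _ _); apply/ffunP => i.
by rewrite !ffunE hK.
Qed.

Lemma transfer_map_inj : injective g -> injective transfer_map.
Proof.
move=> gI x y exy; apply: transfer_ffunP => i; apply: gI.
by rewrite -!val_transfer_map exy.
Qed.

End TransferMap.

Lemma transfer_map_exact (M N X : lmodType B) (g : {linear M -> N})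
    (f : {linear X -> M}) : injective f ->
  (forall x, g x = 0 <-> exists y, f y = x) ->
  forall x, transfer_map g x = 0 <-> exists y, transfer_map f y = x.
Proof.
move=> fI gf x; split=> [gx0 | [y <-]]; last first.
  apply: transfer_ffunP => i; rewrite !val_transfer_map raddf0 ffunE.
  by apply/gf; exists (val y i).
have /choice[y yE] : forall i, exists y, f y = val x i.
  by move=> i; apply/gf; rewrite -val_transfer_map gx0 raddf0 ffunE.
have [z zE] : exists z : transfer X, forall i, val z i = y i.
  apply: transfer_ex => i; apply: fI; rewrite yE linear_sum -transfer1 ffunE.
  by apply: eq_bigr => j _; rewrite linearZ yE.
by exists z; apply: transfer_ffunP => i; rewrite val_transfer_map zE yE.
Qed.

End Transfer.

Section InductionRestriction.
Variables (A B : pzRingType) (iota : {rmorphism B -> A}).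

Section RightDualBasis.
Variables (J : finType) (u : J -> A) (phi : J -> {additive A -> B}).
Hypothesis phiM : forall j a b, phi j (a * iota b) = phi j a * b.
Hypothesis phiE : forall a, a = \sum_j u j * iota (phi j a).

Fact ind_repD (a b : A) i j :
  phi i ((a + b) * u j) = phi i (a * u j) + phi i (b * u j).
Proof. by rewrite mulrDl raddfD. Qed.

Fact ind_repM (a b : A) i j :
  phi i (a * b * u j) = \sum_l phi i (a * u l) * phi l (b * u j).
Proof.
rewrite -mulrA [b * u j]phiE mulr_sumr raddf_sum; apply: eq_bigr => l _.
by rewrite mulrA phiM -phiE.
Qed.

(** The matrix of left multiplication by a, whose column j holds the coordinates of a u_j. As the
    u_j only generate, the matrix of 1 is an idempotent and not the identity in general. *)
Definition ind_rep : mx_rep A B J := MxRep ind_repD ind_repM.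

(* [A (x)_B Z], an element [a (x) z] being encoded by [(phi_j(a) z)_j]. *)
Local Notation ind := (transfer ind_rep).

Section IndModule.
Variable Z : lmodType B.

Fact ind_unit_subproof (z : Z) :
  [ffun i => phi i 1 *: z] \in @transfer_pred _ _ _ ind_rep Z.
Proof.
apply/eqP/ffunP => i; rewrite !ffunE.
under eq_bigr => j _ do rewrite ffunE scalerA.
rewrite -scaler_suml; congr (_ *: z); rewrite [in RHS](phiE 1) raddf_sum.
by apply: eq_bigr => j _; rewrite phiM /= mul1r.
Qed.

Definition ind_unit_fun (z : Z) : restr iota (ind Z) :=
  Transfer (ind_unit_subproof z).

Lemma ind_unitZE a z i : val (a *: (ind_unit_fun z : ind Z)) i = phi i a *: z.
Proof.
rewrite val_transferZ /=; under eq_bigr => j _ do rewrite ffunE scalerA.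
rewrite -scaler_suml; congr (_ *: z); rewrite -[in RHS](mulr1 a) [in RHS](phiE 1).
rewrite mulr_sumr raddf_sum; apply: eq_bigr => j _.
by rewrite mulrA phiM.
Qed.

Fact ind_unit_linear : linear ind_unit_fun.
Proof.
move=> b x y; apply: (@transfer_ffunP _ _ _ ind_rep Z) => i.
rewrite val_transferD restrZ ind_unitZE /= !ffunE scalerDr scalerA.
by rewrite -[iota b]mul1r phiM.
Qed.

Definition ind_unit : {linear Z -> restr iota (ind Z)} := mk_linear ind_unit_linear.

Lemma ind_unit_scaleE a z i : val (a *: (ind_unit z : ind Z)) i = phi i a *: z.
Proof. exact: ind_unitZE. Qed.

Lemma ind_expand (z : ind Z) : z = \sum_j u j *: (ind_unit (val z j) : ind Z).
Proof.
apply: transfer_ffunP => i; rewrite raddf_sum sum_ffunE -[in LHS]transfer1 ffunE.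
by apply: eq_bigr => j _; rewrite ind_unit_scaleE /= mul1r.
Qed.

End IndModule.

Arguments ind_unit {Z}.

Section IndCounit.
Variables (Z : lmodType B) (M : lmodType A) (h : {linear Z -> restr iota M}).

Fact ind_adj_linear : linear (fun z : ind Z => \sum_j u j *: (h (val z j) : M)).
Proof.
move=> a x y; rewrite scaler_sumr.
under eq_bigr => j _ do rewrite val_transferD linearD scalerDr.
rewrite big_split; congr (_ + _).
under eq_bigr => j _ do rewrite val_transferZ linear_sum scaler_sumr.
rewrite exchange_big; apply: eq_bigr => j _ /=.
rewrite scalerA [in RHS](phiE (a * u j)) scaler_suml; apply: eq_bigr => i _.
by rewrite linearZ /= restrZ scalerA.
Qed.

(** The transpose a (x) z |-> a h(z) of h under the adjunction of induction and restriction. *)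
Definition ind_adj : {linear ind Z -> M} := mk_linear ind_adj_linear.

Lemma ind_adj_unit z : ind_adj (ind_unit z) = h z.
Proof.
rewrite /= -[RHS](scale1r (h z : M)) [in RHS](phiE 1) scaler_suml.
by apply: eq_bigr => j _; rewrite ffunE linearZ /= restrZ scalerA.
Qed.

End IndCounit.

(** Induction is left adjoint to restriction, which preserves surjections: the transpose of f lifts
    over B, and the transpose of that lift is the lift over A. *)
Lemma ind_projective P : projective P -> projective (ind P).
Proof.
move=> prP M N g f gS.
have [h gh] := prP _ _ (restr_map iota g) (restr_map iota f \o @ind_unit P) gS.
exists (ind_adj h) => z; rewrite [in RHS](ind_expand z) /= !linear_sum.
by apply: eq_bigr => j _; rewrite !linearZ; congr (_ *: _); apply: gh.
Qed.

Lemma ind_pd_le n Z : pd_le n Z -> pd_le n (ind Z).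
Proof.
apply: (pd_le_functor (Fm := @transfer_map A B J ind_rep)).
- exact: ind_projective.
- exact: transfer_map_surj.
- exact: transfer_map_inj.
- exact: transfer_map_exact.
Qed.

Lemma ind_finitely_generated Z :
  finitely_generated Z -> finitely_generated (ind Z).
Proof.
move=> [n [x xE]]; exists n, (fun l => ind_unit (x l) : ind Z) => z.
have /choice[c cE] : forall j, exists c : 'I_n -> B, val z j = \sum_l c l *: x l.
  by move=> j; apply: xE.
exists (fun l => \sum_j u j * iota (c j l)); rewrite {1}[z]ind_expand.
under eq_bigr => j _ do rewrite cE linear_sum scaler_sumr.
rewrite exchange_big; apply: eq_bigr => l _; rewrite scaler_suml.
by apply: eq_bigr => j _; rewrite linearZ /= restrZ scalerA.
Qed.

End RightDualBasis.

Section LeftDualBasis.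
Variables (J : finType) (v : J -> A) (psi : J -> {additive A -> B}).
Hypothesis psiM : forall j a b, psi j (iota b * a) = b * psi j a.
Hypothesis psiE : forall a, a = \sum_j iota (psi j a) * v j.

Fact coind_repD (a b : A) i j :
  psi j (v i * (a + b)) = psi j (v i * a) + psi j (v i * b).
Proof. by rewrite mulrDr raddfD. Qed.

Fact coind_repM (a b : A) i j :
  psi j (v i * (a * b)) = \sum_l psi l (v i * a) * psi j (v l * b).
Proof.
rewrite mulrA {1}[v i * a]psiE mulr_suml raddf_sum; apply: eq_bigr => l _.
by rewrite -mulrA psiM.
Qed.

(* [Hom_B(A, Z)], a homomorphism [h] being encoded by [(h (v_j))_j]. *)
Definition coind_rep : mx_rep A B J := MxRep coind_repD coind_repM.

(** Restriction is left adjoint to Hom_B(A, -), which preserves surjections because A has a finite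
    dual basis over B. Here [F] is the transpose p |-> (a |-> f (a p)) of f. *)
Lemma restr_projective P : projective P -> projective (restr iota P).
Proof.
move=> prP M N g f gS.
have fE a (p : P) : f (a *: p) = \sum_j psi j a *: f (v j *: p).
  rewrite {1}[a]psiE scaler_suml linear_sum; apply: eq_bigr => j _.
  by rewrite -linearZ restrZ scalerA.
have fP (p : P) : exists z : transfer coind_rep N, forall i, val z i = f (v i *: p).
  by apply: transfer_ex => i; rewrite /= mulr1 -fE.
have [F FE] := choice fP.
have FL : linear F.
  move=> a x y; apply: transfer_ffunP => i; rewrite val_transferD val_transferZ.
  rewrite !FE scalerDr linearD scalerA fE; congr (_ + _).
  by apply: eq_bigr => j _; rewrite FE.
have [h gh] := prP _ _ (transfer_map coind_rep g) (mk_linear FL)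
  (transfer_map_surj gS).
(* Evaluation at 1 of the homomorphism encoded by [h p], through 1 = sum of the psi_j(1) v_j. *)
have hL : linear (fun p : restr iota P => \sum_j psi j 1 *: val (h p) j).
  move=> b x y; have -> : h (b *: x + y) = iota b *: h x + h y by exact: linearP.
  under eq_bigr => j _ do rewrite val_transferD scalerDr.
  rewrite big_split; congr (_ + _); rewrite scaler_sumr.
  under eq_bigr => j _ do rewrite val_transferZ scaler_sumr.
  rewrite exchange_big; apply: eq_bigr => j _ /=.
  rewrite scalerA -psiM mulr1 -[in RHS](mul1r (iota b)) [in RHS](psiE 1).
  rewrite mulr_suml raddf_sum scaler_suml; apply: eq_bigr => l _.
  by rewrite scalerA -psiM mulrA.
exists (mk_linear hL) => p /=; rewrite linear_sum -[in RHS](scale1r (p : P)) fE.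
apply: eq_bigr => j _; rewrite linearZ -FE -val_transfer_map.
by rewrite gh.
Qed.

Lemma restr_pd_le n M : pd_le n M -> pd_le n (restr iota M).
Proof.
apply: (pd_le_functor (Fm := @restr_map _ _ iota)) => //.
exact: restr_projective.
Qed.

Lemma restr_finitely_generated (M : lmodType A) :
  finitely_generated M -> finitely_generated (restr iota M).
Proof.
move=> [n [x xE]]; apply: (@finitely_generatedI _ (J * 'I_n)%type
  (restr iota M) (fun jl => v jl.1 *: x jl.2)) => y; have [c yE] := xE y.
exists (fun jl => psi jl.1 (c jl.2)); rewrite {1}yE.
rewrite -(pair_big xpredT xpredT (fun j l =>
  psi j (c l) *: (v j *: x l : restr iota M))) exchange_big.
apply: eq_bigr => l _ /=; rewrite {1}[c l]psiE scaler_suml.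
by apply: eq_bigr => j _; rewrite restrZ scalerA.
Qed.

End LeftDualBasis.

End InductionRestriction.

(** * The kernel of the counit *)

Section DualBasis.
Variables (k : fieldType) (V : lmodType k) (W : V -> Prop).
Hypotheses (W0 : W 0) (WP : forall a x y, W x -> W y -> W (a *: x + y)).

Let spans n (y : 'I_n -> V) :=
  forall v, exists c : 'I_n -> k, W (v - \sum_l c l *: y l).

(** A relation modulo W with a nonzero coefficient c_l would eliminate y_l and leave a shorter
    spanning family. *)
Let minimal_free n (y : 'I_n -> V) : spans y ->
  (forall m (z : 'I_m -> V), spans z -> (n <= m)%N) ->
  forall c : 'I_n -> k, W (\sum_l c l *: y l) -> forall l, c l = 0.
Proof.
case: n y => [|n] y yS ymin c Wc l; first by case: l.
apply: contrapT => /eqP cl; have := ymin n (fun i => y (lift l i)).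
rewrite ltnn; case/(_ _)/notP => // v; have [d Wd] := yS v.
exists (fun i => d (lift l i) - d l / c l * c (lift l i)).
suff -> : v - \sum_i (d (lift l i) - d l / c l * c (lift l i)) *: y (lift l i) =
  (d l / c l) *: (\sum_i c i *: y i) + (v - \sum_i d i *: y i) by apply: WP.
rewrite addrCA; congr (_ + _); rewrite !(bigD1_ord l) //= scalerDr scalerA divfK //.
rewrite opprD addrACA subrr add0r scaler_sumr -sumrB -sumrN.
by apply: eq_bigr => i _; rewrite scalerBl scalerA opprB.
Qed.

(** A basis of V/W with its coordinate forms, expressed by vectors and forms on V so that the
    quotient need not be constructed. A spanning family of least size is free, which makes the
    coordinates unique and therefore linear. *)
Lemma finite_dual_basis (J : finType) (x : J -> V) :
  (forall v, exists c : J -> k, W (v - \sum_j c j *: x j)) ->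
  exists D : {n : nat & ('I_n -> V) * ('I_n -> {linear V -> k^o})}%type,
    [/\ forall v, W (v - \sum_l ((tagged D).2 l v : k) *: (tagged D).1 l),
        forall l v, W v -> (tagged D).2 l v = 0
      & forall l m, (tagged D).2 l ((tagged D).1 m) = (l == m)%:R].
Proof.
move=> xS; pose P n := `[< exists y : 'I_n -> V, spans y >].
have exP : exists n, P n.
  exists #|J|; apply/asboolP; exists (fun i => x (enum_val i)) => v.
  have [c Wc] := xS v; exists (fun i => c (enum_val i)).
  by rewrite -(big_enum_val (fun j => c j *: x j)).
case: (ex_minnP exP) => n /asboolP[y yS] nmin.
have ymin m (z : 'I_m -> V) : spans z -> (n <= m)%N.
  by move=> zS; apply: nmin; apply/asboolP; exists z.
have free := minimal_free yS ymin.
have [g gP] := choice yS.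
have gU v c : W (v - \sum_l c l *: y l) -> forall l, g v l = c l.
  move=> Wc l; apply/eqP; rewrite eq_sym -subr_eq0; apply/eqP; move: l.
  apply: free; have := WP (-1) Wc (gP v).
  rewrite scaleN1r opprB addrA subrK -sumrB.
  by under eq_bigr => l _ do rewrite -scalerBl.
have gL l : linear (fun v => g v l : k^o).
  move=> a v w; apply: (gU _ (fun l => a * g v l + g w l)).
  have -> : a *: v + w - \sum_l0 (a * g v l0 + g w l0) *: y l0 =
    a *: (v - \sum_l g v l *: y l) + (w - \sum_l g w l *: y l).
    rewrite scalerBr addrACA -opprD scaler_sumr -big_split.
    by congr (_ - _); apply: eq_bigr => i _; rewrite scalerDl scalerA.
  exact: WP.
exists (existT _ n (y, fun l => mk_linear (gL l))); split=> //=.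
- move=> l v Wv; apply: (gU _ (fun _ => 0)).
  by under eq_bigr => i _ do rewrite scale0r; rewrite big1_eq subr0.
- move=> l m; apply: (gU _ (fun l => (l == m)%:R)).
  rewrite (bigD1 m) //= eqxx scale1r big1 ?addr0 ?subrr // => i /negbTE->.
  by rewrite scale0r.
Qed.

End DualBasis.

Lemma big_tag_eq (V : nmodType) (I : finType) (L : I -> finType) (i : I)
    (G : {i : I & L i} -> V) :
  \sum_j (if tag j == i then G j else 0) = \sum_(l : L i) G (Tagged L l).
Proof.
rewrite -big_mkcond /=.
transitivity (\sum_(i' | i' == i) \sum_(l : L i') G (Tagged L l)).
  by rewrite sig_big_dep; apply: eq_big => [j | [] //]; rewrite andbT.
by rewrite big_pred1_eq.
Qed.

Lemma big_option (V : nmodType) (I : finType) (F : option I -> V) :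
  \sum_j F j = F None + \sum_j F (Some j).
Proof.
rewrite (bigD1 None) //= (reindex_omap Some id) /=; last by case.
by congr (_ + _); apply: eq_bigl => j; rewrite eqxx.
Qed.

Section ArrowRemoval.
Variables (k : fieldType) (A B : pzRingType).
Variables (iota : {rmorphism B -> A}) (pi : {rmorphism A -> B}).
Variable kap : {rmorphism k -> A}.
Hypothesis piK : cancel iota pi.
Hypothesis kapC : forall c a, kap c * a = a * kap c.

Variables (S : finType) (y : S -> A) (g : S -> {additive A -> k}).
Hypothesis gM : forall b c a, g b (kap c * a) = c * g b a.
Hypothesis gE : forall a, a = \sum_b kap (g b a) * y b.

Variables (I : finType) (e f ar : I -> A).
Hypothesis eK : forall i, e i * e i = e i.
Hypothesis fK : forall i, f i * f i = f i.

(* [pi] and [phi1] are the coordinates of a dual basis of A as a right B-module, with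
   vectors [1] and [y b * ar i]; left modules over A and B stand for right modules
   over Lam and Gam, whence the reversed products. *)
Variable phi1 : I * S -> {additive A -> B}.
Hypothesis phi1M : forall j a b, phi1 j (a * iota b) = phi1 j a * b.
Hypothesis phi1E : forall a,
  a = iota (pi a) + \sum_(j : I * S) y j.2 * ar j.1 * iota (phi1 j a).
Hypothesis phi1_1 : forall j, phi1 j 1 = 0.
(** In Lam the arguments read f_i a and a_i a. No removed arrow can follow f_i, so the first product
    has zero coordinates and the second can only be cut at its leading a_i. *)
Hypothesis phi1_f : forall j a i, phi1 j (a * f i) = 0.
Hypothesis phi1_ar : forall j a i, iota (phi1 j (a * ar i)) =
  if i == j.1 then kap (g j.2 (a * f i)) * e i else 0.

Let J : finType := option (I * S)%type.
Let u (j : J) : A := if j is Some j' then y j'.2 * ar j'.1 else 1.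
Let phi (j : J) : {additive A -> B} := if j is Some j' then phi1 j' else pi.

Let phiM j a b : phi j (a * iota b) = phi j a * b.
Proof. by case: j => [j|] /=; rewrite ?phi1M // rmorphM piK. Qed.

Let big_IS (V : nmodType) (F : I * S -> V) :
  \sum_j F j = \sum_i \sum_b F (i, b).
Proof. by rewrite pair_bigA; apply: eq_bigr => -[]. Qed.

Let phiE a : a = \sum_j u j * iota (phi j a).
Proof. by rewrite big_option /= mul1r -phi1E. Qed.

Local Notation ind := (transfer (ind_rep phiM phiE)).

(** Through [pi], Z becomes an A-module whose restriction along [iota] is Z again. The transpose of
    the identity of Z retracts the unit. *)
Let Z_retract_ind (Z : lmodType B) :
  exists (s : {linear Z -> restr iota (ind Z)}) (r : {linear restr iota (ind Z) -> Z}),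
    forall x, r (s x) = x.
Proof.
pose M := restr pi Z.
have hL : linear (id : Z -> restr iota M).
  by move=> b x x'; rewrite [in RHS]restrZ [in RHS]restrZ piK.
pose r := ind_adj phiM phiE (mk_linear hL).
have rL : linear (r : restr iota (ind Z) -> Z).
  by move=> b x x'; rewrite restrZ linearP restrZ piK.
exists (ind_unit phiM phiE Z), (mk_linear rL) => x.
exact: (ind_adj_unit phiM phiE (mk_linear hL) x).
Qed.

Section Counit.
Variable X : lmodType A.
Hypothesis Xfg : finitely_generated X.

(** The kernel of multiplication by e_i: a basis of X modulo [W i] represents a basis of e_i X. *)
Let W i (x : restr kap X) := e i *: (x : X) = 0.

Let W0 i : W i 0. Proof. exact: scaler0. Qed.

Let WP i c x x' : W i x -> W i x' -> W i (c *: x + x').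
Proof.
rewrite /W => ex ex'; rewrite scalerDr ex' addr0 restrZ scalerA -kapC -scalerA ex.
exact: scaler0.
Qed.

Let Xspan i : exists D : {n : nat & ('I_n -> restr kap X) *
    ('I_n -> {linear restr kap X -> k^o})}%type,
    [/\ forall v, W i (v - \sum_l ((tagged D).2 l v : k) *: (tagged D).1 l),
        forall l v, W i v -> (tagged D).2 l v = 0
      & forall l m, (tagged D).2 l ((tagged D).1 m) = (l == m)%:R].
Proof.
have [n [x xE]] := Xfg.
apply: (finite_dual_basis (@W0 i) (@WP i) (J := ('I_n * S)%type)
  (x := fun j => y j.2 *: x j.1 : restr kap X)) => v.
have [c cE] := xE v; exists (fun j => g j.2 (c j.1)).
suff -> : \sum_j g j.2 (c j.1) *: (y j.2 *: x j.1 : restr kap X) = v.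
  by rewrite subrr; apply: W0.
rewrite -(pair_big xpredT xpredT (fun l b => g b (c l) *: (y b *: x l : restr kap X))).
rewrite [RHS]cE; apply: eq_bigr => l _ /=; rewrite [in RHS](gE (c l)) scaler_suml.
by apply: eq_bigr => b _; rewrite restrZ scalerA.
Qed.

(** The kernel is generated by the differences a_i (x) x - 1 (x) a_i x, where x represents a basis
    vector of e_i X. That they are independent and suffice is read off the coordinates
    [Some (i, b)], where the second term disappears. *)
Lemma counit_resolution : exists (K : lmodType A) (q : {linear ind (restr iota X) -> X})
    (d : {linear K -> ind (restr iota X)}),
  [/\ forall x, exists z, q z = x, injective d,
      forall z, q z = 0 <-> exists w, d w = z & projective K].
Proof.
have [D DP] := choice Xspan.
pose L i : finType := 'I_(tag (D i)); pose JL : finType := {i : I & L i}.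
pose x i (l : L i) : X := (tagged (D i)).1 l.
pose h i (l : L i) (v : X) : k := (tagged (D i)).2 l v.
have hE i v : \sum_l (kap (h i l v) * e i) *: x i l = e i *: v.
  have [Wv _ _] := DP i; have := Wv v; rewrite /W scalerBr => /eqP.
  rewrite subr_eq0 => /eqP->; rewrite scaler_sumr; apply: eq_bigr => l _.
  by rewrite restrZ scalerA kapC.
have hD i l : {morph h i l : v w / v + w}.
  exact: (linearD ((tagged (D i)).2 l)).
have h0 i l : h i l 0 = 0 by apply: (linear0 ((tagged (D i)).2 l)).
have hZ i l c (v : X) : h i l (kap c *: v) = c * h i l v.
  exact: (linearZZ ((tagged (D i)).2 l) c (v : restr kap X)).
have he i l v : h i l (e i *: v) = h i l v.
  have [_ hW _] := DP i; apply/eqP; rewrite -subr_eq0; apply/eqP.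
  rewrite -[LHS]linearB; apply: hW; rewrite /W.
  by rewrite scalerBr scalerA eK subrr.
have hx i l m : h i l (x i m) = (l == m)%:R by have [_ _ hxi] := DP i; apply: hxi.
(* [K] is the direct sum of left ideals A f_i, one for each basis vector of e_i X, cut out as the
   tuples fixed by right multiplication with the f_i. *)
pose Phi (w : {ffun JL -> A^o}) : {ffun JL -> A^o} :=
  [ffun j => (w j : A) * f (tag j) - w j].
have PhiL : linear Phi.
  move=> a w w'; apply/ffunP => j; rewrite !ffunE mulrDl.
  rewrite scalerBr addrACA -opprD; congr (_ - _); congr (_ + _).
  by rewrite -mulrA.
pose K := kernel (mk_linear PhiL).
have Kf (w : K) j : (val w j : A) * f (tag j) = val w j.
  by have /ffunP/(_ j) := kernelP w; rewrite !ffunE => /eqP; rewrite subr_eq0 => /eqP.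
have valK a (w w' : K) j : val (a *: w + w') j = a * (val w j : A) + val w' j.
  have /ffunP/(_ j) := linearP (kernel_inc (mk_linear PhiL)) a w w'.
  by rewrite !ffunE.
pose unit := ind_unit phiM phiE (restr iota X).
pose kel (j : JL) : ind (restr iota X) :=
  ar (tag j) *: (unit (x _ (tagged j)) : ind _) - unit (ar (tag j) *: x _ (tagged j)).
have dL : linear (fun w : K => \sum_j (val w j : A) *: kel j).
  move=> a w w'; rewrite scaler_sumr -big_split; apply: eq_bigr => j _ /=.
  by rewrite valK scalerDl scalerA.
pose d := mk_linear dL.
have idL : linear (id : restr iota X -> restr iota X) by [].
pose q := ind_adj phiM phiE (mk_linear idL).
have qunit v : q (unit v) = v by exact: ind_adj_unit.
have qd w : q (d w) = 0.
  rewrite linear_sum big1 // => j _; rewrite linearZZ linearB linearZZ.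
  by rewrite !qunit subrr scaler0.
(* Since w_j = w_j f_i, the contribution of 1 (x) a_i x vanishes by [phi1_f], while [phi1_ar]
   evaluates that of a_i (x) x. *)
have dE (w : K) i b : (val (d w) (Some (i, b)) : X) =
    \sum_(l : L i) (kap (g b (val w (Tagged L l))) * e i) *: x i l.
  rewrite /d raddf_sum sum_ffunE.
  rewrite -(big_tag_eq (L := L) i (fun j : JL =>
    (kap (g b (val w j)) * e (tag j)) *: x _ (tagged j))).
  apply: eq_bigr => j _; rewrite scalerBr scalerA val_transferB.
  rewrite /unit !ind_unit_scaleE /= -[in X in _ - X]Kf phi1_f scale0r subr0.
  rewrite restrZ phi1_ar Kf /=; by case: eqP => // _; rewrite scale0r.
(* With zero coordinates at all [Some j], z is 1 (x) v and [q] returns v. In the kernel it is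
   therefore enough to compare the coordinates [Some j]. *)
have zero z : q z = 0 -> (forall j, val z (Some j) = 0) -> z = 0.
  move=> qz z1; have zE : z = unit (val z None).
    rewrite {1}[z]ind_expand big_option [u None]/(1 : A) scale1r big1 ?addr0 // => j _.
    by rewrite z1 (linear0 (ind_unit phiM phiE _)) scaler0.
  by move: qz; rewrite zE qunit => ->; apply: (linear0 unit).
exists K, q, d; split.
- by move=> v; exists (unit v).
- move=> w w' dww'; apply/eqP; rewrite -subr_eq0; apply/eqP.
  have {dww'} : d (w - w') = 0 by rewrite linearB dww' subrr.
  move: (w - w') => {w'}w dw; apply/val_inj/ffunP => -[i l].
  rewrite raddf0 ffunE [LHS]gE big1 // => b _.
  suff -> : g b (val w (existT _ i l)) = 0 by rewrite rmorph0 mul0r.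
  have := dE w i b; rewrite dw raddf0 ffunE => /(congr1 (h i l)).
  rewrite h0 => /esym <-; rewrite (big_morph _ (hD i l) (h0 i l)) (bigD1 l) //=.
  rewrite -scalerA hZ he hx eqxx mulr1 big1 ?addr0 // => m ml.
  by rewrite -scalerA hZ he hx eq_sym (negbTE ml) mulr0.
- move=> z; split=> [qz | [w <-]]; last exact: qd.
  (* By [dE], the coefficients of w_(i,l) should be the l-th coordinates of the z_(i,b). The factor
     f_i puts the tuple into [K]. *)
  pose w0 : {ffun JL -> A^o} :=
    [ffun j => \sum_b (kap (h _ (tagged j) (val z (Some (tag j, b)))) * y b) *
                       f (tag j)].
  have [w wE] : exists w : K, val w = w0.
    apply: kernel_ex; apply/ffunP => j; rewrite !ffunE; apply/eqP; rewrite subr_eq0.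
    rewrite mulr_suml; apply/eqP; apply: eq_bigr => b _.
    by rewrite -mulrA fK.
  exists w; apply/eqP; rewrite -subr_eq0; apply/eqP; apply: zero.
    by rewrite linearB qz qd subrr.
  move=> [i b]; rewrite val_transferB; apply/eqP; rewrite subr_eq0; apply/eqP.
  (* The factor f_i has changed the coefficients by the matrix g_b(y_b' f_i). The idempotent fixing
     z acts on these coordinates through the same matrix, so the two sides agree. *)
  rewrite [LHS]dE wE -[in RHS]transfer1 ffunE big_option /= mul1r phi1_1 scale0r add0r.
  rewrite big_IS /=.
  rewrite (bigD1 i) //= [X in _ + X]big1 ?addr0; last first.
    move=> i' ii'; apply: big1 => b' _.
    by rewrite mul1r restrZ phi1_ar (negbTE ii') scale0r.
  transitivity
    (\sum_b' (kap (g b (y b' * f i))) *: (e i *: (val z (Some (i, b')) : X))).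
    under [RHS]eq_bigr => b' _ do rewrite -hE scaler_sumr.
    rewrite exchange_big; apply: eq_bigr => l _ /=.
    rewrite ffunE raddf_sum rmorph_sum mulr_suml scaler_suml.
    apply: eq_bigr => b' _; rewrite -mulrA gM scalerA mulrA -rmorphM /=.
    by rewrite [g _ _ * _]mulrC.
  by apply: eq_bigr => b' _; rewrite mul1r restrZ phi1_ar eqxx scalerA.
have mP (j : JL) : exists m : K, val m = [ffun j' => if j' == j then f (tag j) else 0].
  apply: kernel_ex; apply/ffunP => j'; rewrite !ffunE.
  by case: eqP => [->|_]; rewrite ?fK ?mul0r subrr.
have [m mE] := choice mP.
have cL j : linear (fun w : K => val w j : A^o).
  by move=> a w w'; rewrite valK.
apply: (projective_dual_basis (m := m) (c := fun j => mk_linear (cL j))) => w.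
have valZ a (w' : K) j : val (a *: w') j = a * (val w' j : A).
  have /ffunP/(_ j) := linearZZ (kernel_inc (mk_linear PhiL)) a w'.
  by rewrite !ffunE.
apply/val_inj/ffunP => j; rewrite raddf_sum sum_ffunE (bigD1 j) //.
rewrite big1 => [|j' jj']; rewrite valZ mE ffunE.
  by rewrite eqxx /= addr0; apply/esym/Kf.
by rewrite eq_sym (negbTE jj') mulr0.
Qed.

(** Dividing Ind (Res X) by the projective [K] may require a term of degree 1, even when Res X is
    projective. *)
Lemma pd_le_of_restr n : pd_le n (restr iota X) -> pd_le (maxn n 1) X.
Proof.
(* The maximum is written as 1 + (n - 1), the successor that [pd_le_coker] expects. *)
rewrite maxnC maxnE => /(pd_le_mono (leq_addr (1 - n) n)).
have -> : (n + (1 - n) = 1 + (n - 1))%N by rewrite -!maxnE maxnC.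
move=> /(ind_pd_le phiM phiE).
have [K [q [d [qS dI kerq prK]]]] := counit_resolution.
exact: pd_le_coker qS dI kerq prK.
Qed.

End Counit.

Variables (J' : finType) (v : J' -> A) (psi : J' -> {additive A -> B}).
Hypothesis psiM : forall j a b, psi j (iota b * a) = b * psi j a.
Hypothesis psiE : forall a, a = \sum_j iota (psi j a) * v j.

Lemma pd_le_ind (Z : lmodType B) : finitely_generated Z ->
  exists Y : lmodType A, finitely_generated Y /\ forall n, pd_le n Y <-> pd_le n Z.
Proof.
move=> Zfg; exists (ind Z); split; first exact: ind_finitely_generated.
move=> n; split; last exact: ind_pd_le.
have [s [r rs]] := Z_retract_ind Z.
by move=> /(restr_pd_le psiM psiE); apply: pd_le_retract rs.
Qed.

End ArrowRemoval.

(** * Quotients by ideals *)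

Definition mk_additive (U V : zmodType) (f : U -> V) (fB : zmod_morphism f) :
  {additive U -> V} := HB.pack f (GRing.isZmodMorphism.Build U V f fB).

Definition mk_rmorphism (U V : pzRingType) (f : U -> V) (fB : zmod_morphism f)
    (fM : monoid_morphism f) : {rmorphism U -> V} :=
  HB.pack f (GRing.isZmodMorphism.Build U V f fB)
            (GRing.isMonoidMorphism.Build U V f fM).

Section QuotientMap.
Variables (R : pzRingType) (I : ideal R).
Local Notation pI := (@quot_pi R I).
Local Notation inI x := (ideal_set I x).

Lemma ideal0 : inI 0. Proof. by case: (idealP I). Qed.
Lemma idealD x y : inI x -> inI y -> inI (x + y).
Proof. by case: (idealP I) => _ ID _; apply: ID. Qed.
Lemma idealMl x y : inI y -> inI (x * y).
Proof. by case: (idealP I) => _ _ IM /(IM x)[]. Qed.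
Lemma idealMr x y : inI x -> inI (x * y).
Proof. by case: (idealP I) => _ _ IM /(IM y)[]. Qed.

Lemma ideal_sum (J : finType) (F : J -> R) : (forall j, inI (F j)) -> inI (\sum_j F j).
Proof.
by move=> IF; elim/big_rec: _ => [|j x _ Ix]; [exact: ideal0 | exact: idealD].
Qed.

Lemma quot_pi0 x : pI x = 0 <-> inI x.
Proof. by rewrite -[0](rmorph0 pI) quot_piP subr0. Qed.

Lemma pi0 : pI 0 = 0. Proof. exact: rmorph0. Qed.
Lemma pi1 : pI 1 = 1. Proof. exact: rmorph1. Qed.
Lemma piD x y : pI (x + y) = pI x + pI y. Proof. exact: rmorphD. Qed.
Lemma piB x y : pI (x - y) = pI x - pI y. Proof. exact: rmorphB. Qed.
Lemma piM x y : pI (x * y) = pI x * pI y. Proof. exact: rmorphM. Qed.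
Lemma pi_sum (J : finType) (F : J -> R) : pI (\sum_j F j) = \sum_j pI (F j).
Proof. exact: rmorph_sum. Qed.

Definition quot_map (f : R -> R) (z : quot_ring I) : quot_ring I :=
  pI (f (quot_repr z)).

Lemma quot_mapE (f : {additive R -> R}) : (forall x, inI x -> inI (f x)) ->
  forall x, quot_map f (pI x) = pI (f x).
Proof.
by move=> fI x; apply/quot_piP; rewrite -raddfB; apply/fI/quot_piP; rewrite quot_reprK.
Qed.

Lemma quot_ex (z : quot_ring I) : exists x, z = pI x.
Proof. by exists (quot_repr z); rewrite quot_reprK. Qed.

End QuotientMap.

Lemma ideal_gen_ind (R : pzRingType) (G : set R) (P : R -> Prop) :
  P 0 -> (forall x y, P x -> P y -> P (x + y)) ->
  (forall x y, P y -> P (x * y) /\ P (y * x)) ->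
  (forall x, G x -> P x) -> forall x, ideal_set (ideal_gen G) x -> P x.
Proof. by move=> P0 PD PM GP x; apply; split; [split | exact: GP]. Qed.

Lemma ideal_gen_sub (R : pzRingType) (G : set R) x : G x -> ideal_set (ideal_gen G) x.
Proof. by move=> Gx P [_]; apply. Qed.

(** * Algebras with a basis of paths *)

(* MathComp's algebras are nontrivial rings, whereas the path algebra of the
   empty quiver is the zero ring. *)
Record scaling (k : pzRingType) (R : pzRingType) := Scaling {
  scaling_fun :> k -> R -> R;
  scalingA : forall c d x, scaling_fun c (scaling_fun d x) = scaling_fun (c * d) x;
  scaling1 : left_id 1 scaling_fun;
  scalingDr : right_distributive scaling_fun +%R;
  scalingDl : forall x, {morph scaling_fun^~ x : c d / c + d};
  scaling_mull : forall c x y, scaling_fun c x * y = scaling_fun c (x * y);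
  scaling_mulr : forall c x y, x * scaling_fun c y = scaling_fun c (x * y)
}.

Definition scaled (k R : pzRingType) (S : scaling k R) : Type := R.

Section Scaled.
Variables (k R : pzRingType) (S : scaling k R).

HB.instance Definition _ := GRing.PzRing.on (scaled S).
HB.instance Definition _ := GRing.Zmodule_isLmodule.Build k (scaled S)
  (@scalingA _ _ S) (@scaling1 _ _ S) (@scalingDr _ _ S) (@scalingDl _ _ S).

Lemma pz_scalerAl c (x y : scaled S) : (c *: x) * y = c *: (x * y).
Proof. exact: (scaling_mull S). Qed.

Lemma pz_scalerAr c (x y : scaled S) : x * (c *: y) = c *: (x * y).
Proof. exact: (scaling_mulr S). Qed.

End Scaled.

(* The path algebra enters only through a basis indexed by paths; R stays abstract
   so that its elements are never unfolded to finitely supported functions. *)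
Section PathBasis.
Variables (k : fieldType) (Q : quiver) (R0 : pzRingType) (S : scaling k R0).
Local Notation R := (scaled S).
Variable bs : qpath Q -> R.
Variable occurs : arrow Q -> R -> Prop.
Hypothesis bsM : forall p q,
  bs p * bs q = if pcat p q is Some r then bs r else 0.
Hypothesis bs1 : 1 = \sum_(v : vertex Q) bs (trivial_path v).
(** Linear independence of the paths, in the form of a universal property. *)
Hypothesis bs_linext : forall F : qpath Q -> R,
  exists f : {linear R -> R}, forall p, f (bs p) = F p.
Hypothesis bs_support : forall x, exists2 r : seq (k * qpath Q),
  x = \sum_(cp <- r) cp.1 *: bs cp.2
  & forall cp b, cp \in r -> b \in parrows cp.2 -> occurs b x.

Local Notation idem v := (bs (trivial_path v)).
Local Notation arr b := (bs (arrow_path b)).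
Implicit Types (p q : qpath Q) (v w : vertex Q) (s : seq (arrow Q)) (x y : R).

Lemma bs_mulS p q r : pcat p q = Some r -> bs p * bs q = bs r.
Proof. by move=> E; rewrite bsM E. Qed.

Lemma bs_mul0 p q : pcat p q = None -> bs p * bs q = 0.
Proof. by move=> E; rewrite bsM E. Qed.

Lemma idem_basis v p : idem v * bs p = if v == psrc p then bs p else 0.
Proof. by rewrite bsM pcat1p; case: ifP. Qed.

Lemma idemM v w : idem v * idem w = if v == w then idem v else 0.
Proof. by rewrite idem_basis; case: eqP => [->|]. Qed.

Lemma idem_arrow v b : idem v * arr b = if v == src b then arr b else 0.
Proof. exact: idem_basis. Qed.

Lemma arrow_idem b v : arr b * idem v = if tgt b == v then arr b else 0.
Proof. by rewrite bsM pcatp1; case: ifP. Qed.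

(** Paths as arrow sequences, on which one can recurse; a sequence that is not a walk from v gives
    0. *)
Definition walk v s : R := if insub (v, s) is Some p then bs p else 0.

Lemma walkE p : walk (psrc p) (parrows p) = bs p.
Proof.
rewrite /walk; have -> : (psrc p, parrows p) = val p by rewrite [RHS]surjective_pairing.
by rewrite valK.
Qed.

Lemma walk_nil v : walk v [::] = idem v.
Proof. exact: (walkE (trivial_path v)). Qed.

Lemma walk_cons b s : is_walk (tgt b) s ->
  walk (src b) (b :: s) = arr b * walk (tgt b) s.
Proof.
move=> sP; have sP' : is_walk (src b) (b :: s) by rewrite /= eqxx.
have := walkE (@QPath Q (tgt b, s) sP).
have := walkE (@QPath Q (src b, b :: s) sP').
rewrite /psrc /parrows /= => -> ->.
have := pcatP (arrow_path b) (@QPath Q (tgt b, s) sP).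
rewrite {1}/ptgt {1}/psrc /= eqxx => -[r br [sr _ ar]].
by rewrite (bs_mulS br); congr (bs _); apply: qpath_inj.
Qed.

Lemma walk_rcons v b s : is_walk v (rcons s b) ->
  walk v (rcons s b) = walk v s * arr b.
Proof.
move=> sbP; have : is_walk v (s ++ [:: b]) by rewrite cats1.
rewrite is_walk_cat => /andP[sP /= /andP[/eqP sb _]].
have := walkE (@QPath Q (v, s) sP).
have := walkE (@QPath Q (v, rcons s b) sbP).
rewrite /psrc /parrows /= => -> ->.
have := pcatP (@QPath Q (v, s) sP) (arrow_path b).
rewrite {1}/ptgt {1}/psrc /= -sb eqxx => -[r br [sr _ ar]].
rewrite (bs_mulS br); congr (bs _); apply: qpath_inj; first by rewrite sr.
by rewrite ar cats1.
Qed.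

Lemma bs_ind_basis (P : R -> Prop) :
  P 0 -> (forall c x y, P x -> P y -> P (c *: x + y)) ->
  (forall p, P (bs p)) -> forall x, P x.
Proof.
move=> P0 PL PU x; have [r -> _] := bs_support x.
elim: r => [|cp r IH]; first by rewrite big_nil.
by rewrite big_cons; apply: PL.
Qed.

Lemma bs_ind (P : R -> Prop) :
  P 0 -> (forall c x y, P x -> P y -> P (c *: x + y)) ->
  (forall v, P (idem v)) -> (forall b x, P x -> P (arr b * x)) ->
  forall x, P x.
Proof.
move=> P0 PL Pe Pb; apply: bs_ind_basis => // p.
have Pw v s : is_walk v s -> P (walk v s).
  elim: s v => [|b s IH] v; first by rewrite walk_nil.
  by move=> /= /andP[/eqP<- sP]; rewrite walk_cons //; apply/Pb/IH.
by rewrite -walkE; apply: Pw; apply: (valP p).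
Qed.

Definition linext (F : qpath Q -> R) : {linear R -> R} := sval (cid (bs_linext F)).

Lemma linextU F p : linext F (bs p) = F p.
Proof. exact: svalP (cid (bs_linext F)) p. Qed.

Section Avoid.
Variable sp : pred (arrow Q).

Definition avoid : {linear R -> R} :=
  linext (fun p => if has sp (parrows p) then 0 else bs p).

Lemma avoid_basis p : avoid (bs p) = if has sp (parrows p) then 0 else bs p.
Proof. exact: linextU. Qed.

Lemma avoid_idem v : avoid (idem v) = idem v.
Proof. exact: avoid_basis. Qed.

Lemma avoid_arrow b : avoid (arr b) = if sp b then 0 else arr b.
Proof. by rewrite avoid_basis /= orbF. Qed.

Lemma avoid1 : avoid 1 = 1.
Proof. by rewrite bs1 linear_sum; apply: eq_bigr => v _; rewrite avoid_idem. Qed.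

Lemma avoidM x y : avoid (x * y) = avoid x * avoid y.
Proof.
elim/bs_ind_basis: x => [|c x x' IH IH'|p].
- by rewrite mul0r linear0 mul0r.
- by rewrite mulrDl pz_scalerAl !linearP IH IH' mulrDl pz_scalerAl.
elim/bs_ind_basis: y => [|c x x' IH IH'|q].
- by rewrite mulr0 linear0 mulr0.
- by rewrite mulrDr pz_scalerAr !linearP IH IH' mulrDr pz_scalerAr.
rewrite (avoid_basis p) (avoid_basis q); have := pcatP p q.
case: ifP => [_ [r pqr [_ _ ar]]|_ pq0].
  rewrite (bs_mulS pqr) avoid_basis ar has_cat.
  by do 2!case: has; rewrite ?mul0r ?mulr0 //= (bs_mulS pqr).
rewrite (bs_mul0 pq0) linear0.
by do 2!case: has; rewrite ?mul0r ?mulr0 //= (bs_mul0 pq0).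
Qed.

Lemma avoid_id x : (forall b, sp b -> ~ occurs b x) -> avoid x = x.
Proof.
move=> xsp; have [r xE rx] := bs_support x; rewrite xE linear_sum.
apply: eq_big_seq => cp rcp; rewrite linearZ avoid_basis /=.
case: ifP => // /hasP[b bp spb].
by case: (xsp b spb); apply: rx rcp bp.
Qed.

End Avoid.

Definition bilin (h : R -> R -> R) : Prop :=
  (forall y, linear (h^~ y)) /\ (forall x, linear (h x)).

Lemma bilin0l h y : bilin h -> h 0 y = 0.
Proof. by case=> hl _; apply: (linear0 (mk_linear (hl y))). Qed.

Lemma bilin0r h x : bilin h -> h x 0 = 0.
Proof. by case=> _ hr; apply: (linear0 (mk_linear (hr x))). Qed.

Lemma bilin_mull h z : bilin h -> bilin (fun x y => h (z * x) y).
Proof.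
move=> [hl hr]; split=> [y c x x'|x c y y']; last exact: hr.
by rewrite mulrDr pz_scalerAr hl.
Qed.

Lemma bilin_mulr h z : bilin h -> bilin (fun x y => h x (y * z)).
Proof.
move=> [hl hr]; split=> [y c x x'|x c y y']; first exact: hl.
by rewrite mulrDl pz_scalerAl hr.
Qed.

(** * Cutting paths at an arrow *)

Section Cut.
Variable i : arrow Q.

(** The prefix already read is absorbed into h, so each cut starts afresh from a trivial path. *)
Fixpoint cut_walk (h : R -> R -> R) v s : R :=
  if s is b :: s' then
    (if b == i then h (idem v) (walk (tgt b) s') else 0) +
    cut_walk (fun x y => h (arr b * x) y) (tgt b) s'
  else 0.

(* [cut h] maps a path p to the sum of the [h p1 p2] over the factorizations
   [p = p1 i p2]. *)
Definition cut h : {linear R -> R} :=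
  linext (fun p => cut_walk h (psrc p) (parrows p)).

Lemma cut_basis h p : cut h (bs p) = cut_walk h (psrc p) (parrows p).
Proof. exact: linextU. Qed.

Lemma cut_walkL c h h' v s :
  cut_walk (fun x y => c *: h x y + h' x y) v s =
  c *: cut_walk h v s + cut_walk h' v s.
Proof.
elim: s h h' v => [|b s IH] h h' v /=; first by rewrite scaler0 addr0.
rewrite (IH (fun x y => h (arr b * x) y) (fun x y => h' (arr b * x) y)).
by rewrite scalerDr [RHS]addrACA; case: (b == i); rewrite ?scaler0 ?addr0.
Qed.

Lemma cutL c h h' x : cut (fun x y => c *: h x y + h' x y) x = c *: cut h x + cut h' x.
Proof.
elim/bs_ind_basis: x => [|d x y IH IH'|p]; first by rewrite !linear0 addr0.
  rewrite !linearP IH IH' scalerDr !scalerA [d * c]mulrC.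
  by rewrite addrACA.
by rewrite !cut_basis cut_walkL.
Qed.

Lemma cut_walk0 v s : cut_walk (fun _ _ => 0) v s = 0.
Proof. by elim: s v => //= b s IH v; rewrite IH addr0 if_same. Qed.

Lemma cutB h h' x : cut h x - cut h' x = cut (fun y z => h y z - h' y z) x.
Proof.
rewrite -scaleN1r addrC -cutL; congr (cut _ x).
by apply/funext => y; apply/funext => z; rewrite scaleN1r addrC.
Qed.

Lemma cut0 x : cut (fun _ _ => 0) x = 0.
Proof.
elim/bs_ind_basis: x => [|d x y IH IH'|p]; first exact: linear0.
  by rewrite linearP IH IH' scaler0 addr0.
by rewrite cut_basis cut_walk0.
Qed.

Lemma cut_sum (J : finType) (h : J -> R -> R -> R) x :
  cut (fun x y => \sum_j h j x y) x = \sum_j cut (h j) x.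
Proof.
elim: (index_enum J) => [|j r IH].
  rewrite big_nil -[RHS](cut0 x); congr (cut _ x).
  by apply/funext => z; apply/funext => t; rewrite big_nil.
rewrite big_cons -IH -[cut (h j) x]scale1r -cutL; congr (cut _ x).
by apply/funext => z; apply/funext => t; rewrite big_cons scale1r.
Qed.

Lemma cut_map (f : {linear R -> R}) h x : f (cut h x) = cut (fun x y => f (h x y)) x.
Proof.
elim/bs_ind_basis: x => [|d x y IH IH'|p]; first by rewrite !linear0.
  by rewrite !linearP IH IH'.
rewrite !cut_basis; elim: (parrows p) (psrc p) h => [|b s IH] v h /=.
  exact: linear0.
by rewrite linearD IH; case: eqP => // _; rewrite linear0.
Qed.

Lemma cut_mull h (z : R) x : z * cut h x = cut (fun x y => z * h x y) x.
Proof.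
have zL : linear (fun y : R => z * y) by move=> c y y'; rewrite mulrDr pz_scalerAr.
exact: (cut_map (mk_linear zL)).
Qed.

Lemma cut_mulr h (z : R) x : cut h x * z = cut (fun x y => h x y * z) x.
Proof.
have zL : linear (fun y : R => y * z) by move=> c y y'; rewrite mulrDl pz_scalerAl.
exact: (cut_map (mk_linear zL)).
Qed.

Lemma eq_cut (h h' : R -> R -> R) x :
  (forall y z, h y z = h' y z) -> cut h x = cut h' x.
Proof.
move=> hh'; congr (cut _ x).
by apply/funext => y; apply/funext => z; apply: hh'.
Qed.

Lemma cut_idem h v : cut h (idem v) = 0.
Proof. exact: cut_basis. Qed.

Lemma cut1 h : cut h 1 = 0.
Proof. by rewrite bs1 linear_sum big1 // => v _; rewrite cut_idem. Qed.

Lemma cut_basis_notin h p : i \notin parrows p -> cut h (bs p) = 0.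
Proof.
rewrite cut_basis; elim: (parrows p) (psrc p) h => [|b s IH] v h //=.
rewrite in_cons negb_or eq_sym => /andP[/negbTE-> si].
by rewrite add0r IH.
Qed.

Lemma cut_notin h x : ~ occurs i x -> cut h x = 0.
Proof.
move=> xi; have [r xE rx] := bs_support x; rewrite xE linear_sum big_seq big1 //.
move=> cp rcp; rewrite linearZZ cut_basis_notin ?scaler0 //.
by apply/negP => icp; apply: xi; apply: rx rcp icp.
Qed.

Lemma cut_avoid (sp : pred (arrow Q)) h x : sp i -> cut h (avoid sp x) = 0.
Proof.
move=> spi; elim/bs_ind_basis: x => [|d x y IH IH'|p]; first by rewrite !linear0.
  by rewrite !linearP IH IH' scaler0 addr0.
rewrite avoid_basis; case: ifP => [_|/hasP psp]; first exact: linear0.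
by apply: cut_basis_notin; apply/negP => ip; case: psp; exists i.
Qed.

Lemma cut_walk_idem h v w s : bilin h -> is_walk v s ->
  cut_walk (fun x y => h (idem w * x) y) v s = if w == v then cut_walk h v s else 0.
Proof.
move=> hB; case: s => [|b s] /=; first by rewrite if_same.
move=> /andP[/eqP<- sP]; rewrite idemM.
have -> : (fun x y => h (idem w * (arr b * x)) y) =
    (fun x y => if w == src b then h (arr b * x) y else 0).
  apply/funext => x; apply/funext => y; rewrite mulrA idem_arrow.
  by case: eqP => // _; rewrite mul0r bilin0l.
by case: (w =P src b) => [->//|_]; rewrite cut_walk0 bilin0l // if_same addr0.
Qed.

Lemma cut_mul_idem h v y : bilin h ->
  cut h (idem v * y) = cut (fun x y => h (idem v * x) y) y.
Proof.
move=> hB; elim/bs_ind_basis: y => [|d x y IH IH'|p].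
- by rewrite mulr0 !linear0.
- by rewrite mulrDr pz_scalerAr !linearP IH IH'.
rewrite idem_basis !cut_basis cut_walk_idem //; last exact: (valP p).
by case: eqP => [_|_]; rewrite ?cut_basis ?linear0.
Qed.

(** The extra term is the cut at the leading b. Its factor [idem (tgt b)] discards the paths of y
    that do not start where b ends. *)
Lemma cut_mul_arrow h b y : bilin h ->
  cut h (arr b * y) = cut (fun x y => h (arr b * x) y) y +
    (if b == i then h (idem (src b)) (idem (tgt b) * y) else 0).
Proof.
move=> hB; elim/bs_ind_basis: y => [|d x y IH IH'|p].
- by rewrite !mulr0 bilin0r // if_same !linear0 addr0.
- rewrite !mulrDr !pz_scalerAr !linearP IH IH' scalerDr addrACA; congr (_ + _).
  by case: (b == i); rewrite ?scaler0 ?addr0 // (hB.2 _ d).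
have := pcatP (arrow_path b) p; have -> : ptgt (arrow_path b) = tgt b by [].
rewrite idem_basis; case: eqP => [bp [r bpr [sr _ ar]]|bp bp0].
  rewrite (bs_mulS bpr) !cut_basis sr ar /= addrC bp; congr (_ + _).
  by case: eqP => // _; rewrite walkE.
rewrite (bs_mul0 bp0) linear0 cut_basis bilin0r // if_same addr0.
have -> : (fun x y => h (arr b * x) y) = (fun x y => h (arr b * (idem (tgt b) * x)) y).
  by apply/funext => x; apply/funext => y; rewrite mulrA arrow_idem eqxx.
rewrite (@cut_walk_idem (fun x y => h (arr b * x) y)) ?(introF eqP bp) //.
  exact: bilin_mull.
exact: (valP p).
Qed.

(** The Leibniz rule of the double derivation: an occurrence of i in a product lies in exactly one
    factor. The other factor is multiplied into the adjacent argument of h. *)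
Lemma cutM h x y : bilin h ->
  cut h (x * y) =
  cut (fun x' y' => h (x * x') y') y + cut (fun x' y' => h x' (y' * y)) x.
Proof.
elim/bs_ind: x h y => [|c x x' IH IH'|v|b x IH] h y hB.
- rewrite mul0r !linear0 addr0 -[LHS](cut0 y); congr (cut _ y).
  by apply/funext => z; apply/funext => t; rewrite mul0r bilin0l.
- rewrite mulrDl pz_scalerAl !linearP IH // IH' // scalerDr addrACA -cutL.
  congr (cut _ y + _); apply/funext => z; apply/funext => t.
  by rewrite mulrDl pz_scalerAl (hB.1 _ c).
- by rewrite cut_idem addr0 cut_mul_idem.
rewrite -mulrA !cut_mul_arrow ?IH //; try exact: bilin_mull; try exact: bilin_mulr.
rewrite -!addrA mulrA; congr (cut _ y + _).
by apply/funext => z; apply/funext => t; rewrite mulrA.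
Qed.

End Cut.

Lemma walk_ideal_pow (J : ideal R) m v s : (forall b, ideal_set J (arr b)) ->
  is_walk v s -> (m <= size s)%N -> ideal_set (ideal_pow J m) (walk v s).
Proof.
move=> Jarr; elim: m v s => [|m IH] v s sP ms; first exact: ideal_gen_sub.
elim/last_ind: s sP ms => [//|s b _] sP; rewrite size_rcons ltnS walk_rcons // => ms.
apply: ideal_gen_sub; exists (walk v s); last by exists (arr b); first exact: Jarr.
apply: IH => //; by move: sP; rewrite -cats1 is_walk_cat => /andP[].
Qed.

Section Removal.
Variable sp : pred (arrow Q).
Local Notation T := {b : arrow Q | sp b}.
Local Notation eps := (avoid sp).

Lemma sum_special (b : arrow Q) (F : arrow Q -> R) :
  \sum_(i : T) (if b == val i then F (val i) else 0) = if sp b then F b else 0.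
Proof.
case: ifP => [spb|nspb]; last first.
  by apply: big1 => -[i spi] _ /=; case: eqP => // bi; rewrite bi spi in nspb.
rewrite (bigD1 (Sub b spb)) //= eqxx big1 ?addr0 // => i ib.
by case: eqP => // bi; case/eqP: ib; apply: val_inj.
Qed.

Lemma src_arrow b : idem (src b) * arr b = arr b.
Proof. by rewrite idem_arrow eqxx. Qed.

Lemma arrow_tgt b : arr b * idem (tgt b) = arr b.
Proof. by rewrite arrow_idem eqxx. Qed.

(** A path that meets [sp] is p a q with a its first arrow in [sp]; cuts at later arrows vanish
    because [eps] kills their prefix. *)
Lemma avoid_cut_first x :
  x = eps x + \sum_(i : T) cut (val i) (fun x y => eps x * arr (val i) * y) x.
Proof.
elim/bs_ind: x => [|c x y IH IH'|v|b x IH].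
- by rewrite linear0 big1 ?addr0 // => i _; rewrite linear0.
- under eq_bigr => i _ do rewrite linearP.
  by rewrite linearP big_split -scaler_sumr addrACA -scalerDr -IH -IH'.
- by rewrite avoid_idem big1 ?addr0 // => i _; rewrite cut_idem.
have hB (i : T) : bilin (fun x y => eps x * arr (val i) * y).
  split=> [y c x1 x2|x1 c y1 y2]; first by rewrite linearP !mulrDl !pz_scalerAl.
  by rewrite mulrDr pz_scalerAr.
have E (i : T) : cut (val i) (fun x y => eps x * arr (val i) * y) (arr b * x) =
    eps (arr b) * cut (val i) (fun x y => eps x * arr (val i) * y) x +
    (if b == val i then arr (val i) * x else 0).
  rewrite cut_mul_arrow // cut_mull avoid_idem; congr (_ + _).
    by apply: eq_cut => y z; rewrite avoidM !mulrA.
  by case: eqP => // <-; rewrite src_arrow mulrA arrow_tgt.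
under eq_bigr => i _ do rewrite E.
rewrite big_split /= (sum_special b (fun i => arr i * x)) -mulr_sumr avoidM.
rewrite addrA -mulrDr -IH avoid_arrow.
by case: ifP; rewrite ?mul0r ?add0r ?addr0.
Qed.

Lemma avoid_cut_last x :
  x = eps x + \sum_(i : T) cut (val i) (fun x y => x * arr (val i) * eps y) x.
Proof.
elim/bs_ind: x => [|c x y IH IH'|v|b x IH].
- by rewrite linear0 big1 ?addr0 // => i _; rewrite linear0.
- under eq_bigr => i _ do rewrite linearP.
  by rewrite linearP big_split -scaler_sumr addrACA -scalerDr -IH -IH'.
- by rewrite avoid_idem big1 ?addr0 // => i _; rewrite cut_idem.
have hB (i : T) : bilin (fun x y => x * arr (val i) * eps y).
  split=> [y c x1 x2|x1 c y1 y2]; first by rewrite !mulrDl !pz_scalerAl.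
  by rewrite linearP mulrDr pz_scalerAr.
have E (i : T) : cut (val i) (fun x y => x * arr (val i) * eps y) (arr b * x) =
    arr b * cut (val i) (fun x y => x * arr (val i) * eps y) x +
    (if b == val i then arr (val i) * eps x else 0).
  rewrite cut_mul_arrow // cut_mull avoidM avoid_idem; congr (_ + _).
    by apply: eq_cut => y z; rewrite !mulrA.
  by case: eqP => // <-; rewrite src_arrow mulrA arrow_tgt.
under eq_bigr => i _ do rewrite E.
rewrite big_split /= (sum_special b (fun i => arr i * eps x)) -mulr_sumr avoidM.
rewrite addrCA avoid_arrow {1}IH mulrDr addrC; congr (_ + _).
by case: ifP; rewrite ?mul0r ?add0r ?addr0.
Qed.

(** * Bound quiver algebras *)

Section Ideal.
Variables (I : ideal R) (G : set R).
Hypothesis GI : ideal_gen G = I :> set R.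
Hypothesis G_sp : forall g b, G g -> sp b -> ~ occurs b g.
Local Notation inI x := (ideal_set I x).

Lemma ideal_ind (P : R -> Prop) :
  P 0 -> (forall x y, P x -> P y -> P (x + y)) ->
  (forall x y, P y -> P (x * y) /\ P (y * x)) ->
  (forall x, G x -> P x) -> forall x, inI x -> P x.
Proof. by move=> P0 PD PM GP x; rewrite -GI; apply: ideal_gen_ind. Qed.

Lemma G_ideal x : G x -> inI x.
Proof. by move=> Gx; rewrite -GI; apply: ideal_gen_sub. Qed.

Lemma idealZ c x : inI x -> inI (c *: x).
Proof. by move=> Ix; rewrite -[x]mul1r -pz_scalerAl; apply: idealMl. Qed.

(** [eps] is multiplicative and fixes the generators in G, in which no removed arrow occurs. *)
Lemma avoid_ideal x : inI x -> inI (eps x).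
Proof.
move=> Ix; suff [] : inI x /\ inI (eps x) by [].
elim/ideal_ind: Ix => [|y z [Iy Iey] [Iz Iez]|y z [Iz Iez]|y Gy].
- by rewrite linear0; split; apply: ideal0.
- by rewrite linearD; split; apply: idealD.
- by rewrite !avoidM; do 2!split; try exact: idealMl; try exact: idealMr.
rewrite avoid_id; first by split; apply: G_ideal.
by move=> b spb; apply: G_sp.
Qed.

Lemma short_walks_span m :
  (forall v s, is_walk v s -> (m <= size s)%N -> inI (walk v s)) ->
  forall x, exists c : vertex Q * {bseq m of arrow Q} -> k,
    inI (x - \sum_j c j *: walk j.1 j.2).
Proof.
move=> longI; elim/bs_ind_basis => [|c x y [d dE] [d' dE']|p].
- exists (fun=> 0); rewrite big1 ?subr0 => [|j _]; [exact: ideal0 | exact: scale0r].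
- exists (fun j => c * d j + d' j).
  rewrite (_ : _ - _ = c *: (x - \sum_j d j *: walk j.1 j.2) +
    (y - \sum_j d' j *: walk j.1 j.2)); first by apply/idealD/dE'/idealZ.
  rewrite scalerBr addrACA -opprD scaler_sumr -big_split; congr (_ - _).
  by apply: eq_bigr => j _; rewrite scalerDl scalerA.
have [pm|mp] := leqP (size (parrows p)) m.
  exists (fun j => (j == (psrc p, Bseq pm))%:R).
  rewrite (bigD1 (psrc p, Bseq pm)) //= eqxx scale1r walkE big1 ?addr0 ?subrr.
    exact: ideal0.
  by move=> j /negbTE->; apply: scale0r.
exists (fun=> 0); rewrite big1 ?subr0 => [|j _]; last exact: scale0r.
by rewrite -walkE; apply: longI (valP p) (ltnW mp).
Qed.

Lemma cut_in_ideal i h x : (forall y z, inI (h y z)) -> inI (cut i h x).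
Proof.
move=> hI; elim/bs_ind_basis: x => [|c y z IHy IHz|p].
- by rewrite linear0; apply: ideal0.
- by rewrite linearP; apply: idealD => //; apply: idealZ.
rewrite cut_basis; elim: (parrows p) (psrc p) h hI => [|b s IH] v h hI /=.
  exact: ideal0.
apply: idealD; last exact: IH.
by case: ifP => _; [apply: hI | apply: ideal0].
Qed.

(** The forms that induce a bilinear map Lam x Lam -> Lam. *)
Definition stable_bilin (h : R -> R -> R) : Prop :=
  [/\ bilin h, forall x y, inI x -> inI (h x y) & forall x y, inI y -> inI (h x y)].

(* The product rule [cutM] reduces this to the generators of I, on which
   [cut i h] vanishes because i does not occur in them. *)
Lemma cut_ideal i h x : sp i -> stable_bilin h -> inI x -> inI (cut i h x).
Proof.
move=> spi hS Ix.
suff [_] : inI x /\ forall h, stable_bilin h -> inI (cut i h x) by apply.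
elim/ideal_ind: Ix {h hS} => [|y z [Iy cy] [Iz cz]|y z [Iz cz]|y Gy].
- by split=> [|h _]; rewrite ?linear0; apply: ideal0.
- split=> [|h hS]; first exact: idealD.
  by rewrite linearD; apply: idealD; [apply: cy | apply: cz].
- have step h : stable_bilin h -> inI (cut i h (y * z)) /\ inI (cut i h (z * y)).
    move=> hS; have [hB hl hr] := hS.
    rewrite !cutM //; split; apply: idealD.
    + apply: cz; split=> [|u w Iu|u w Iw]; first exact: bilin_mull.
        by apply/hl/idealMl.
      exact: hr.
    + apply: cut_in_ideal => u w; apply/hr/idealMl; exact: Iz.
    + apply: cut_in_ideal => u w; apply/hl/idealMr; exact: Iz.
    + apply: cz; split=> [|u w Iu|u w Iw]; first exact: bilin_mulr.
        exact: hl.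
      by apply/hr/idealMr.
  by split; split=> [|h /step[]//]; [apply: idealMl | apply: idealMr].
split=> [|h _]; first exact: G_ideal.
by rewrite cut_notin; [apply: ideal0 | apply: G_sp].
Qed.

Variable Gs : set (quot_ring I).
Hypothesis Gs_sp : forall z, Gs z <-> exists2 b, sp b & z = quot_pi I (arr b).
Hypothesis tgt_src : forall b b' x, sp b -> sp b' ->
  inI (idem (tgt b) * x * idem (src b')).

Local Notation Lam := (quot_ring I).
Local Notation L := (ideal_gen Gs).
Local Notation Gam := (quot_ring L).
Local Notation pI := (@quot_pi R I).
Local Notation pG := (@quot_pi Lam L).

Lemma quot_avoidE x : quot_map eps (pI x) = pI (eps x).
Proof. exact: quot_mapE avoid_ideal x. Qed.

Lemma quot_avoid_removed z : ideal_set L z -> quot_map eps z = 0.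
Proof.
elim/ideal_gen_ind => [|x y ex ey|x y ey|x /Gs_sp[b spb ->]].
- by rewrite -[X in quot_map _ X](pi0 I) quot_avoidE linear0 (pi0 I).
- have [x' xE] := quot_ex x; have [y' yE] := quot_ex y.
  move: ex ey; rewrite xE yE -(piD I) !quot_avoidE linearD (piD I) => -> ->.
  exact: addr0.
- have [x' xE] := quot_ex x; have [y' yE] := quot_ex y.
  move: ey; rewrite xE yE -!(piM I) !quot_avoidE !avoidM !(piM I) => ->.
  by rewrite mulr0 mul0r.
by rewrite quot_avoidE avoid_arrow spb (pi0 I).
Qed.

Definition pGI (x : R) : Gam := pG (pI x).

Lemma pGI0 : pGI 0 = 0. Proof. by rewrite /pGI (pi0 I) (pi0 L). Qed.
Lemma pGI1 : pGI 1 = 1. Proof. by rewrite /pGI (pi1 I) (pi1 L). Qed.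
Lemma pGID x y : pGI (x + y) = pGI x + pGI y.
Proof. by rewrite /pGI (piD I) (piD L). Qed.
Lemma pGIB x y : pGI (x - y) = pGI x - pGI y.
Proof. by rewrite /pGI (piB I) (piB L). Qed.
Lemma pGIM x y : pGI (x * y) = pGI x * pGI y.
Proof. by rewrite /pGI (piM I) (piM L). Qed.

Lemma pGIZ c x : pGI (c *: x) = pGI (c *: (1 : R)) * pGI x.
Proof. by rewrite -pGIM pz_scalerAl mul1r. Qed.

Lemma pGI_ex (z : Gam) : exists x, z = pGI x.
Proof. by have [w ->] := quot_ex z; have [x ->] := quot_ex w; exists x. Qed.

Lemma removed_arrow b : sp b -> pGI (arr b) = 0.
Proof.
move=> spb; apply: (quot_pi0 L _).2; apply: ideal_gen_sub.
by apply/Gs_sp; exists b.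
Qed.

Lemma removed_avoid x : pGI (eps x) = pGI x.
Proof.
elim/bs_ind: x => [|c x y IH IH'|v|b x IH].
- by rewrite linear0.
- by rewrite linearP !pGID IH' pGIZ IH -pGIZ.
- by rewrite avoid_idem.
rewrite avoidM avoid_arrow !pGIM IH; case: ifP => // spb.
by rewrite pGI0 removed_arrow.
Qed.

(** Independent of the representatives, because [eps] preserves I and the induced map kills L. *)
Definition section_fun (z : Gam) : Lam := quot_map eps (quot_repr z).

Lemma section_funE x : section_fun (pGI x) = pI (eps x).
Proof.
rewrite /section_fun; set w := quot_repr _.
have : ideal_set L (w - pI x) by apply/quot_piP; rewrite quot_reprK.
have [w' ->] := quot_ex w; move=> /quot_avoid_removed.
rewrite -(piB I) !quot_avoidE linearB (piB I) => /eqP.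
by rewrite subr_eq0 => /eqP.
Qed.

Fact section_zmod : zmod_morphism section_fun.
Proof.
move=> x y; have [x' ->] := pGI_ex x; have [y' ->] := pGI_ex y.
by rewrite -pGIB !section_funE linearB (piB I).
Qed.

Lemma section_funM (z w : Gam) : section_fun (z * w) = section_fun z * section_fun w.
Proof.
have [x' ->] := pGI_ex z; have [y' ->] := pGI_ex w.
by rewrite -pGIM !section_funE avoidM (piM I).
Qed.

Fact section_monoid : monoid_morphism (section_fun : Gam^c -> Lam^c).
Proof.
split=> [|x y]; last exact: section_funM.
by rewrite -[1]/(1 : Gam) -pGI1 section_funE avoid1 (pi1 I).
Qed.

Definition section_map : {rmorphism Gam^c -> Lam^c} :=
  mk_rmorphism (section_zmod : zmod_morphism (section_fun : Gam^c -> Lam^c))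
    section_monoid.

Fact proj_monoid : monoid_morphism (pG : Lam^c -> Gam^c).
Proof. by split=> [|x y]; [apply: (pi1 L) | apply: (piM L y x)]. Qed.

Definition proj_map : {rmorphism Lam^c -> Gam^c} :=
  mk_rmorphism (@piB _ L : zmod_morphism (pG : Lam^c -> Gam^c)) proj_monoid.

Definition scalar_fun (c : k) : Lam := pI (c *: (1 : R)).

Fact scalar_zmod : zmod_morphism (scalar_fun : k -> Lam^c).
Proof. by move=> c d; rewrite /scalar_fun scalerBl (piB I). Qed.

Lemma scalar_mull c x : scalar_fun c * pI x = pI (c *: x).
Proof. by rewrite -(piM I) pz_scalerAl mul1r. Qed.

Lemma scalar_mulr c x : pI x * scalar_fun c = pI (c *: x).
Proof. by rewrite -(piM I) pz_scalerAr mulr1. Qed.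

Lemma scalar_funM c d : scalar_fun (c * d) = scalar_fun d * scalar_fun c.
Proof. by rewrite [in RHS]/scalar_fun scalar_mulr scalerA. Qed.

Fact scalar_monoid : monoid_morphism (scalar_fun : k -> Lam^c).
Proof.
split=> [|c d]; last exact: scalar_funM.
by rewrite /scalar_fun scale1r (pi1 I).
Qed.

Definition scalar_map : {rmorphism k -> Lam^c} :=
  mk_rmorphism scalar_zmod scalar_monoid.

Lemma section_mapK : cancel section_map proj_map.
Proof.
move=> z; have [x ->] := pGI_ex z.
by rewrite -[LHS]/(pG (section_fun _)) section_funE; apply: removed_avoid.
Qed.

(** * Dual bases of the algebra over its quotient *)

Section Bases.
Variables (n : nat) (y : 'I_n -> R) (g : 'I_n -> {linear R -> k^o}).
Hypothesis gI : forall b x, inI x -> g b x = 0.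
Hypothesis gE : forall x, inI (x - \sum_b (g b x : k) *: y b).

Local Notation e j := (idem (src (val j))).
Local Notation f j := (idem (tgt (val j))).
Local Notation ar j := (arr (val j)).

(** The b-th coordinate of p e_i (x) f_i q with respect to the basis y of Lam in the right factor:
    that factor gives the scalar, the left one the value. In [cutr_form] the two factors exchange
    roles. *)
Definition cutl_form (j : T * 'I_n) (p q : R) : R :=
  (g j.2 (f j.1 * q) : k) *: (p * e j.1).
Definition cutr_form (j : T * 'I_n) (p q : R) : R :=
  (g j.2 (p * e j.1) : k) *: (f j.1 * q).

Lemma cutl_stable j : stable_bilin (cutl_form j).
Proof.
split=> [|p q Ip|p q Iq].
- split=> [q c p p'|p c q q'] /=.
    by rewrite /cutl_form mulrDl pz_scalerAl scalerDr !scalerA mulrC.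
  rewrite /cutl_form mulrDr pz_scalerAr linearP /= scalerDl.
  by rewrite -[in LHS]scalerA.
- by apply/idealZ/idealMr.
- by rewrite /cutl_form gI ?scale0r; [apply: ideal0 | apply: idealMl].
Qed.

Lemma cutr_stable j : stable_bilin (cutr_form j).
Proof.
split=> [|p q Ip|p q Iq].
- split=> [q c p p'|p c q q'] /=.
    rewrite /cutr_form mulrDl pz_scalerAl linearP /= scalerDl.
    by rewrite -[in LHS]scalerA.
  by rewrite /cutr_form mulrDr pz_scalerAr scalerDr !scalerA mulrC.
- by rewrite /cutr_form gI ?scale0r; [apply: ideal0 | apply: idealMr].
- by apply/idealZ/idealMl.
Qed.

Lemma sum_pair (F : T * 'I_n -> R) : \sum_j F j = \sum_i \sum_b F (i, b).
Proof. by rewrite pair_bigA; apply: eq_bigr => -[]. Qed.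

Lemma cutl_expand (w : R) : inI (w - (eps w +
  \sum_(j : T * 'I_n) eps (cut (val j.1) (cutl_form j) w) * (ar j.1 * y j.2))).
Proof.
rewrite {1}[w]avoid_cut_first sum_pair opprD addrACA subrr add0r -sumrB.
apply: ideal_sum => i.
under eq_bigr => b _ do rewrite cut_map cut_mulr.
rewrite -cut_sum cutB; apply: cut_in_ideal => p q.
have -> : \sum_b eps (cutl_form (i, b) p q) * (ar i * y b) =
    eps p * ar i * \sum_b (g b (f i * q) : k) *: y b.
  rewrite mulr_sumr; apply: eq_bigr => b _.
  rewrite /cutl_form linearZZ avoidM avoid_idem pz_scalerAl pz_scalerAr.
  by rewrite -!mulrA [_ * (ar i * _)]mulrA src_arrow.
by rewrite -[ar i in X in X - _]arrow_tgt -!mulrA -!mulrBr mulrA; apply/idealMl/gE.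
Qed.

Lemma cutr_expand (w : R) : inI (w - (eps w +
  \sum_(j : T * 'I_n) y j.2 * ar j.1 * eps (cut (val j.1) (cutr_form j) w))).
Proof.
rewrite {1}[w]avoid_cut_last sum_pair opprD addrACA subrr add0r -sumrB.
apply: ideal_sum => i.
under eq_bigr => b _ do rewrite cut_map cut_mull.
rewrite -cut_sum cutB; apply: cut_in_ideal => p q.
have -> : \sum_b y b * ar i * eps (cutr_form (i, b) p q) =
    (\sum_b (g b (p * e i) : k) *: y b) * (ar i * eps q).
  rewrite mulr_suml; apply: eq_bigr => b _.
  rewrite /cutr_form linearZZ avoidM avoid_idem pz_scalerAl pz_scalerAr.
  by rewrite -!mulrA [ar i * _]mulrA arrow_tgt.
by rewrite -[ar i in X in X - _]src_arrow mulrA -!mulrA mulrA -mulrBl; apply/idealMr/gE.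
Qed.

(** Passing to Gam kills the prefixes that contain a removed arrow, so only the cut at the first
    removed arrow counts; for [psi_fun] it is the last one. *)
Definition phi_fun j (z : Lam) : Gam := pG (quot_map (cut (val j.1) (cutl_form j)) z).
Definition psi_fun j (z : Lam) : Gam := pG (quot_map (cut (val j.1) (cutr_form j)) z).

Lemma phi_funE j x : phi_fun j (pI x) = pGI (cut (val j.1) (cutl_form j) x).
Proof.
congr pG; apply: quot_mapE => w.
exact: cut_ideal (valP j.1) (cutl_stable j).
Qed.

Lemma psi_funE j x : psi_fun j (pI x) = pGI (cut (val j.1) (cutr_form j) x).
Proof.
congr pG; apply: quot_mapE => w.
exact: cut_ideal (valP j.1) (cutr_stable j).
Qed.

Fact phi_zmod j : zmod_morphism (phi_fun j).
Proof.
move=> a b; have [x ->] := quot_ex a; have [x' ->] := quot_ex b.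
by rewrite -(piB I) !phi_funE linearB pGIB.
Qed.

Fact psi_zmod j : zmod_morphism (psi_fun j).
Proof.
move=> a b; have [x ->] := quot_ex a; have [x' ->] := quot_ex b.
by rewrite -(piB I) !psi_funE linearB pGIB.
Qed.

Definition phi_map j : {additive Lam^c -> Gam^c} := 
  mk_additive (phi_zmod j : zmod_morphism (phi_fun j : Lam^c -> Gam^c)).
Definition psi_map j : {additive Lam^c -> Gam^c} := 
  mk_additive (psi_zmod j : zmod_morphism (psi_fun j : Lam^c -> Gam^c)).

(** The image of the section avoids the removed arrows, so in the Leibniz rule only the cuts inside
    a remain. *)
Lemma phi_funM j (z : Gam) a : phi_fun j (section_fun z * a) = z * phi_fun j a.
Proof.
have [x ->] := quot_ex a; have [w ->] := pGI_ex z.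
have [cB _ _] := cutl_stable j.
rewrite section_funE -(piM I) !phi_funE cutM // cut_avoid ?(valP j.1) //.
  rewrite addr0 -(@eq_cut _ (fun p q : R => eps w * cutl_form j p q)) => [|p q].
    by rewrite -cut_mull pGIM removed_avoid.
  by rewrite /cutl_form pz_scalerAr mulrA.
Qed.

Lemma psi_funM j (z : Gam) a : psi_fun j (a * section_fun z) = psi_fun j a * z.
Proof.
have [x ->] := quot_ex a; have [w ->] := pGI_ex z.
have [cB _ _] := cutr_stable j.
rewrite section_funE -(piM I) !psi_funE cutM // cut_avoid ?(valP j.1) //.
  rewrite add0r -(@eq_cut _ (fun p q : R => cutr_form j p q * eps w)) => [|p q].
    by rewrite -cut_mulr pGIM removed_avoid.
  by rewrite /cutr_form pz_scalerAl mulrA.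
Qed.

Lemma phi_fun_expand (a : Lam) : a = section_fun (pG a) +
  \sum_(j : T * 'I_n) section_fun (phi_fun j a) * (pI (ar j.1) * pI (y j.2)).
Proof.
have [x ->] := quot_ex a; have /quot_piP xE := cutl_expand x.
rewrite [LHS]xE -/(pGI x) section_funE (piD I) (pi_sum I).
congr (_ + _); apply: eq_bigr => j _.
by rewrite phi_funE section_funE !(piM I).
Qed.

Lemma psi_fun_expand (a : Lam) : a = section_fun (pG a) +
  \sum_(j : T * 'I_n) pI (y j.2) * pI (ar j.1) * section_fun (psi_fun j a).
Proof.
have [x ->] := quot_ex a; have /quot_piP xE := cutr_expand x.
rewrite [LHS]xE -/(pGI x) section_funE (piD I) (pi_sum I).
congr (_ + _); apply: eq_bigr => j _.
by rewrite psi_funE section_funE !(piM I).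
Qed.

Lemma phi_fun1 j : phi_fun j 1 = 0.
Proof. by rewrite -[1]/(pI 1) phi_funE cut1 pGI0. Qed.

(** Every cut has a prefix of the form f_i p e_j, which lies in I by [tgt_src]. *)
Lemma phi_fun_tgt j (i : T) a : phi_fun j (pI (f i) * a) = 0.
Proof.
have [x ->] := quot_ex a; have [cB _ _] := cutl_stable j.
rewrite -(piM I) phi_funE cut_mul_idem //.
rewrite -(@eq_cut _ (fun p q : R => f i * cutl_form j p q * e j.1)) => [|p q].
  rewrite -cut_mulr -cut_mull /pGI (_ : pI _ = 0) ?(pi0 L) //.
  by apply/quot_pi0/tgt_src; [apply: (valP i) | apply: (valP j.1)].
by rewrite /cutl_form pz_scalerAr pz_scalerAl -!mulrA idemM eqxx.
Qed.

Definition coord_fun b (a : Lam) : k := g b (quot_repr a).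

Lemma coord_funE b x : coord_fun b (pI x) = g b x.
Proof.
apply/eqP; rewrite -subr_eq0 -[_ - _]/((g b _ : k^o) - g b x) -linearB; apply/eqP/gI.
by apply/quot_piP; rewrite quot_reprK.
Qed.

(** A cut inside a leaves the removed arrow a_i in the prefix, which [eps] kills. There remains the
    cut at the leading a_i, with prefix e_i. *)
Lemma phi_fun_arrow j (i : T) a : section_fun (phi_fun j (pI (ar i) * a)) =
  if i == j.1 then
    pI (e i) * scalar_fun (coord_fun j.2 (pI (f i) * a)) else 0.
Proof.
have [x ->] := quot_ex a; have [cB _ _] := cutl_stable j.
rewrite -!(piM I) phi_funE section_funE cut_mul_arrow // linearD coord_funE.
rewrite -(@eq_cut _ (fun p q : R => ar i * cutl_form j p q)) => [|p q]; last first.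
  by rewrite /cutl_form pz_scalerAr mulrA.
rewrite -cut_mull avoidM avoid_arrow (valP i) mul0r add0r (inj_eq val_inj).
case: eqP => [->|_]; last by rewrite linear0 (pi0 I).
rewrite pz_scalerAr mulr1 /cutl_form idemM eqxx mulrA idemM eqxx.
by rewrite linearZZ avoid_idem.
Qed.

Fact coord_zmod b : zmod_morphism (coord_fun b : Lam^c -> k).
Proof.
move=> a a'; have [x ->] := quot_ex a; have [x' ->] := quot_ex a'.
rewrite -[coord_fun b _]/(coord_fun b (pI x - pI x' : Lam)) -(piB I) !coord_funE.
exact: (linearB (g b)).
Qed.

Definition coord_map b : {additive Lam^c -> k} := mk_additive (coord_zmod b).

Lemma coord_funZ b c (a : Lam) : coord_fun b (a * scalar_fun c) = c * coord_fun b a.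
Proof.
have [x ->] := quot_ex a; rewrite scalar_mulr !coord_funE.
exact: (linearZZ (g b)).
Qed.

Lemma coord_fun_expand (a : Lam) : a = \sum_b pI (y b) * scalar_fun (coord_fun b a).
Proof.
have [x ->] := quot_ex a; have /quot_piP xE := gE x.
rewrite [LHS]xE (pi_sum I); apply: eq_bigr => b _.
by rewrite scalar_mulr coord_funE.
Qed.

Let v (j : option (T * 'I_n)%type) : Lam^c :=
  if j is Some j' then pI (y j'.2) * pI (ar j'.1) else 1.
Let psi (j : option (T * 'I_n)%type) : {additive Lam^c -> Gam^c} :=
  if j is Some j' then psi_map j' else proj_map.

Let psiM j (a : Lam^c) (b : Gam^c) : psi j (section_map b * a) = b * psi j a.
Proof.
case: j => [j|] /=; first exact: psi_funM.
by rewrite rmorphM section_mapK.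
Qed.

Let psiE (a : Lam^c) : a = \sum_j section_map (psi j a) * v j.
Proof. by rewrite big_option /= mulr1; apply: psi_fun_expand. Qed.

Let phiE (a : Lam^c) : a = section_map (proj_map a) +
  \sum_(j : T * 'I_n) ((pI (y j.2) : Lam^c) * pI (ar j.1)) * section_map (phi_map j a).
Proof. exact: phi_fun_expand. Qed.

Let phiM j (a : Lam^c) (b : Gam^c) : phi_map j (a * section_map b) = phi_map j a * b.
Proof. exact: phi_funM. Qed.

Lemma restr_section n' (M : lmodType Lam^c) : finitely_generated M -> pd_le n' M ->
  exists M' : lmodType Gam^c, [/\ finitely_generated M', pd_le n' M'
    & forall m, pd_le m M' -> pd_le (maxn m 1) M].
Proof.
move=> Mfg Mn; exists (restr section_map M); split.
- exact: (restr_finitely_generated (v := v) (psi := psi) psiE Mfg).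
- exact: (restr_pd_le (v := v) (psi := psi) psiM psiE Mn).
move=> m; apply: (pd_le_of_restr (kap := scalar_map) (g := coord_map)
  (e := fun i : T => pI (e i) : Lam^c) (f := fun i : T => pI (f i) : Lam^c)
  section_mapK _ _ _ _ _ phiM phiE) => //.
- move=> c a; have [x ->] := quot_ex a.
  rewrite -[LHS]/(pI x * scalar_fun c) -[RHS]/(scalar_fun c * pI x).
  by rewrite scalar_mulr scalar_mull.
- by move=> b c a; apply: coord_funZ.
- exact: coord_fun_expand.
- by move=> i; rewrite -[LHS]/(pI (e i) * pI (e i) : Lam) -(piM I) idemM eqxx.
- by move=> i; rewrite -[LHS]/(pI (f i) * pI (f i) : Lam) -(piM I) idemM eqxx.
- exact: phi_fun1.
- by move=> j a i; apply: phi_fun_tgt.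
- by move=> j a i; apply: phi_fun_arrow.
Qed.

Lemma ind_section n' (M : lmodType Gam^c) : finitely_generated M -> pd_le n' M ->
  exists M' : lmodType Lam^c, [/\ finitely_generated M', pd_le n' M'
    & forall m, pd_le m M' -> pd_le (maxn m 1) M].
Proof.
move=> Mfg Mn; have [M' [M'fg M'M]] := pd_le_ind (y := fun b => pI (y b) : Lam^c)
  (ar := fun i : T => pI (ar i) : Lam^c) section_mapK phiM phiE psiM psiE Mfg.
exists M'; split=> //; first exact/M'M.
by move=> m /M'M; apply: pd_le_mono; apply: leq_maxl.
Qed.

End Bases.

Lemma fin_dim_removal (J : finType) (z : J -> R) :
  (forall x, exists c : J -> k, inI (x - \sum_j c j *: z j)) ->
  (fin_dim Lam <= Order.max (fin_dim Gam) (Fin 1))%O /\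
  (fin_dim Gam <= Order.max (fin_dim Lam) (Fin 1))%O.
Proof.
move=> zE; have WP c x x' : inI x -> inI x' -> inI (c *: x + x').
  by move=> Ix Ix'; apply/idealD/Ix'/idealZ.
have [[n [y g]] /= [gE gI _]] := finite_dual_basis (ideal0 I) WP zE.
split; apply: fin_dim_le_max => M n' Mfg Mn'.
  exact: (@restr_section n y g gI gE n' M Mfg Mn').
exact: (@ind_section n y g gI gE n' M Mfg Mn').
Qed.

End Ideal.
End Removal.
End PathBasis.

(** * The path algebra *)

Lemma malgU_scale (K : choiceType) (R : nzRingType) (c : R) (p : K) :
  << c *g p >> = c *: (<< p >> : {malg R[K]}).
Proof. by apply/malgP => q; rewrite mcoeffZ !mcoeffU mulrnAr mulr1. Qed.

Section PathAlgebraBasis.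
Variables (k : fieldType) (Q : quiver).
Local Notation kQ := (path_algebra k Q).
Implicit Types (p q : qpath Q) (x y : kQ).

Lemma pa_basisE (c : k) p : << c *g p >> = c *: (<< p >> : kQ).
Proof. exact: malgU_scale. Qed.

Lemma pa_sumE x : x = \sum_(p <- msupp x) x@_p *: (<< p >> : kQ).
Proof. by rewrite [LHS]monalgE; apply: eq_bigr => p _; apply: pa_basisE. Qed.

Fact pa_basisZ (c d : k) o : pa_basis (c * d) o = c *: pa_basis d o :> kQ.
Proof.
by case: o => [p|] /=; rewrite ?scaler0 // pa_basisE [in RHS]pa_basisE scalerA.
Qed.

Fact pa_scalerAl (c : k) x y : (c *: x) * y = c *: (x * y).
Proof.
rewrite -[LHS]/(pa_mul _ _) -[x * y]/(pa_mul _ _).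
rewrite (@pa_mulw _ _ (msupp x) (msupp y)) ?msuppZ_le ?fsubset_refl //.
rewrite /pa_mul scaler_sumr; apply: eq_bigr => p _; rewrite scaler_sumr.
by apply: eq_bigr => q _; rewrite mcoeffZ -mulrA pa_basisZ.
Qed.

Fact pa_scalerAr (c : k) x y : x * (c *: y) = c *: (x * y).
Proof.
rewrite -[LHS]/(pa_mul _ _) -[x * y]/(pa_mul _ _).
rewrite (@pa_mulw _ _ (msupp x) (msupp y)) ?msuppZ_le ?fsubset_refl //.
rewrite /pa_mul scaler_sumr; apply: eq_bigr => p _; rewrite scaler_sumr.
by apply: eq_bigr => q _; rewrite mcoeffZ mulrCA -pa_basisZ.
Qed.

Definition pa_scaling : scaling k kQ :=
  @Scaling k kQ *:%R (@scalerA k kQ) (@scale1r k kQ) (@scalerDr k kQ)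
    (fun x c d => @scalerDl k kQ x c d) pa_scalerAl pa_scalerAr.

Definition pa_bs (p : qpath Q) : scaled pa_scaling := << p >>.

Lemma pa_bsM p q : pa_bs p * pa_bs q = if pcat p q is Some r then pa_bs r else 0.
Proof.
rewrite -[LHS]/(pa_mul _ _) pa_mulUU mulr1.
by case: (pcat p q).
Qed.

Lemma pa_bs1 : 1 = \sum_(v : vertex Q) pa_bs (trivial_path v).
Proof. by []. Qed.

Section LinearExtension.
Variable F : qpath Q -> kQ.

Definition linext_fun x : kQ := \sum_(p <- msupp x) x@_p *: F p.

Fact linext_funEw (d : {fset qpath Q}) x : (msupp x `<=` d)%fset ->
  linext_fun x = \sum_(p <- d) x@_p *: F p.
Proof.
move=> xd; apply: (big_fset_incl _ xd) => p _ /mcoeff_outdom ->.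
exact: scale0r.
Qed.

Fact linext_linear (c : k) x y :
  linext_fun (c *: x + y) = c *: linext_fun x + linext_fun y.
Proof.
pose d := (msupp x `|` msupp y)%fset.
have xd : (msupp x `<=` d)%fset by exact: fsubsetUl.
have yd : (msupp y `<=` d)%fset by exact: fsubsetUr.
have cd : (msupp (c *: x + y) `<=` d)%fset.
  apply: fsubset_trans (msuppD_le _ _) _; rewrite fsubUset yd andbT.
  exact: fsubset_trans (msuppZ_le _ _) xd.
rewrite (linext_funEw xd) (linext_funEw yd) (linext_funEw cd) scaler_sumr -big_split.
by apply: eq_bigr => p _; rewrite mcoeffD mcoeffZ scalerDl scalerA.
Qed.

Lemma linext_funU p : linext_fun << p >> = F p.
Proof.
rewrite (@linext_funEw [fset p]%fset) ?msuppU_le //.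
by rewrite big_seq_fset1 mcoeffUU scale1r.
Qed.

End LinearExtension.

Lemma pa_bs_linext (F : qpath Q -> scaled pa_scaling) :
  exists f : {linear scaled pa_scaling -> scaled pa_scaling},
    forall p, f (pa_bs p) = F p.
Proof.
have fL : linear (linext_fun F : scaled pa_scaling -> scaled pa_scaling).
  exact: linext_linear.
by exists (mk_linear fL) => p; apply: linext_funU.
Qed.

Lemma pa_bs_support (x : scaled pa_scaling) : exists2 r : seq (k * qpath Q),
  x = \sum_(cp <- r) cp.1 *: pa_bs cp.2
  & forall cp b, cp \in r -> b \in parrows cp.2 -> arrow_occurs b (x : kQ).
Proof.
exists [seq (mcoeff p (x : kQ), p) | p <- msupp (x : kQ)].
  by rewrite big_map; apply: pa_sumE.
by move=> cp b /mapP[p px ->] bp; exists p.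
Qed.

End PathAlgebraBasis.

(** Left multiplication by f x is a homomorphism from eR to fR that sends e to f x e. *)
Lemma Hom_trivial_mul (R : pzRingType) (e f : R) :
  @Hom_trivial R^c (principal_right_ideal e) (principal_right_ideal f) ->
  forall x, f * x * e = 0.
Proof.
move=> Hom0 x; have hP (u : principal_right_ideal e) :
    (f * (x * (val u : R)) : R^c^o) \in in_right_ideal f.
  by apply/asboolP; exists (x * (val u : R)).
have hL : linear (fun u => PrincipalRightIdeal_of (hP u)).
  move=> a u w; apply: val_inj; rewrite [RHS]linearP /=.
  have E (b c d : R) : f * (x * (c * b + d)) = f * (x * c) * b + f * (x * d).
    by rewrite !mulrDr !mulrA.
  exact: E.
have eP : (e : R^c^o) \in in_right_ideal e by apply/asboolP; exists 1; rewrite mulr1.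
have := Hom0 (mk_linear hL) (PrincipalRightIdeal_of eP).
by move=> /(congr1 val) /=; rewrite mulrA.
Qed.

Local Open Scope classical_set_scope.

Theorem theorem4p7 (k : fieldType) (Q : quiver) (I : ideal (path_algebra k Q))
    (t : nat) (a : 'I_t -> arrow Q) :
  let Lam := quot_ring I in
  let e i : Lam := quot_pi I (pa_idem k (src (a i))) in
  let f i : Lam := quot_pi I (pa_idem k (tgt (a i))) in
  let abar i : Lam := quot_pi I (pa_arrow k (a i)) in
  let Gam := quot_ring (ideal_gen [set abar i | i in [set: 'I_t]]) in
  admissible I ->
  (exists2 G : set (path_algebra k Q), minimal_generating_set I G &
     forall i g, G g -> ~ arrow_occurs (a i) g) ->
  (forall i j, @Hom_trivial Lam^c (principal_right_ideal (e i))
      (principal_right_ideal (f j))) ->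
  [/\ (fin_dim Lam <= Order.max (fin_dim Gam) (Fin 1%N))%O,
      (fin_dim Gam <= Order.max (fin_dim Lam) (Fin 1%N))%O
    & (fin_dim Lam < Infty)%O <-> (fin_dim Gam < Infty)%O].
Proof.
move=> Lam e f abar Gam [m [_ JmI _]] [G [GI _] G_a] Hom0.
(* The family may repeat an arrow; with a predicate the sums run over distinct removed arrows. *)
pose sp : pred (arrow Q) := fun b => [exists i, a i == b].
have G_sp g b : G g -> sp b -> ~ arrow_occurs b g.
  by move=> Gg /existsP[i /eqP<-]; apply: G_a.
have Gs_sp z : [set abar i | i in [set: 'I_t]]%classic z <->
    exists2 b, sp b & z = quot_pi I (pa_arrow k b).
  split=> [[i _ <-]|[b /existsP[i /eqP<-] ->]]; last by exists i.
  by exists (a i) => //; apply/existsP; exists i.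
have tgt_src b b' x : sp b -> sp b' ->
    ideal_set I (pa_idem k (tgt b) * x * pa_idem k (src b')).
  move=> /existsP[j /eqP<-] /existsP[i /eqP<-]; apply/quot_pi0.
  by rewrite !piM; apply: Hom_trivial_mul (Hom0 i j) _.
(* Admissibility puts the long walks into I, so that finitely many short ones span Lam. *)
have longI v s : is_walk v s -> (m <= size s)%N ->
    ideal_set I (walk (@pa_bs k Q) v s).
  move=> sP ms; apply: JmI.
  apply: (walk_ideal_pow (J := arrow_ideal k Q) (@pa_bsM k Q) _ sP ms) => b.
  by apply: ideal_gen_sub; exists b.
have [LG GL] := fin_dim_removal (@pa_bsM k Q) (@pa_bs1 k Q) (@pa_bs_linext k Q)
  (@pa_bs_support k Q) GI G_sp Gs_sp tgt_src
  (short_walks_span (@pa_bs_support k Q) longI).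
split=> //; split=> [/enat_ltInftyP[d dE]|/enat_ltInftyP[d dE]].
  by apply: le_lt_trans GL _; rewrite dE gt_max.
by apply: le_lt_trans LG _; rewrite dE gt_max.
Qed.
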